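(* Fix $\mathbf A=[A\,|\,B]\in\mathcal B^{\mathbb C}$. Then for every $1\le n\le\sharp_1(\sigma(\boldsymbol{\hat\omega},\mathbf A))=(N-1)d+\operatorname{rank}(B)$, the $n$-th eigenvalue $\boldsymbol{\hat\omega}\mapsto\lambda_n(\boldsymbol{\hat\omega},\mathbf A)$ is continuous on the whole space $\hat\Omega$ of Sturm-Liouville equations of Atkinson type.
   Context: Let $d\ge1$, $N>1$, and fix a partition $a=a_0<b_0<a_1<b_1<\cdots<a_N<b_N=b$. $\hat\Omega$ is the set of triples $\boldsymbol{\hat\omega}=(\hat P^{-1},\hat Q,\hat W)$ of integrable Hermitian $d\times d$ matrix-valued functions on $(a,b)$ (elements of $L((a,b),\mathbb C^{d\times d})$, $L=L^1$) such that: $\hat P^{-1}\equiv0$ on $[a_i,b_i]$ and $\int_{a_i}^{b_i}\hat W(s)\,ds$ is positive definite for $0\le i\le N$; and $\hat Q\equiv\hat W\equiv0$ on $[b_{j-1},a_j]$ and $\int_{b_{j-1}}^{a_j}\hat P^{-1}(s)\,ds$ is invertible for $1\le j\le N$. $\hat\Omega$ carries the topology induced from $(L((a,b),\mathbb C^{d\times d}))^3$. $\mathcal B^{\mathbb C}$ is the space of self-adjoint boundary conditions: the quotient of $\{(A,B)\in\mathcal M_{2d,4d}(\mathbb C):\operatorname{rank}(A,B)=2d,\ AB^*=BA^*\}$ ($A,B$ being $2d\times2d$) by left multiplication by $\mathrm{GL}(2d,\mathbb C)$. The class of $(A,B)$ is written $[A\,|\,B]$. The Sturm-Liouville problem of Atkinson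 type $(\boldsymbol{\hat\omega},\mathbf A)$ is $$-(\hat Py')'+\hat Qy=\lambda\hat Wy\ \text{ on }(a,b),\qquad A\begin{pmatrix}-y(a)\\ y(b)\end{pmatrix}+B\begin{pmatrix}(\hat Py')(a)\\ (\hat Py')(b)\end{pmatrix}=0,$$ where the equation is understood as the first-order system $u'=\hat P^{-1}v$, $v'=(\hat Q-\lambda\hat W)u$ with $u=y$, $v=\hat Py'$. Eigenvalues are those $\lambda$ with a nontrivial solution, counted with multiplicity (number of linearly independent eigenfunctions). They are real and finite in number. $\sharp_1(\sigma(\boldsymbol{\hat\omega},\mathbf A))$ is their number counted with multiplicity, and they are listed as $\lambda_1(\boldsymbol{\hat\omega},\mathbf A)\le\lambda_2(\boldsymbol{\hat\omega},\mathbf A)\le\cdots$. *)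

(* Defs.v *)
From mathcomp Require Import all_boot all_order all_algebra.
From mathcomp Require Import complex.
From mathcomp Require Import all_classical all_reals all_analysis.
Import Order.TTheory GRing.Theory Num.Theory.
Import numFieldNormedType.Exports.
Import ComplexField.Normc.

Set Implicit Arguments.
Unset Strict Implicit.
Unset Printing Implicit Defensive.

Local Open Scope classical_set_scope.
Local Open Scope ring_scope.
Local Open Scope complex_scope.
Local Open Scope sesquilinear_scope.

(* R[i] carries no derivative, measurability or integral over the real line,
   so those notions are taken on real and imaginary parts. *)
Section ComplexValued.
Context {R : realType}.
Local Notation mu := (@lebesgue_measure R).
Implicit Types (f g : R -> R[i]) (D : set R).

Definition cintegrable D f :=
  mu.-integrable D (EFin \o (fun x => complex.Re (f x))) /\
  mu.-integrable D (EFin \o (fun x => complex.Im (f x))).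

Definition cintegral D f : R[i] :=
  (\int[mu]_(x in D) complex.Re (f x)) +i* (\int[mu]_(x in D) complex.Im (f x)).

Definition cis_derive (x : R) f (l : R[i]) :=
  is_derive x 1 (fun t => complex.Re (f t)) (complex.Re l) /\
  is_derive x 1 (fun t => complex.Im (f t)) (complex.Im l).

(* Absolute continuity on [a, b]: the [x i, y i], i < n, range over the finite
   families of non-overlapping subintervals. *)
Definition abs_continuous (a b : R) f :=
  forall e : R, 0 < e -> exists2 r : R, 0 < r &
    forall (n : nat) (x y : 'I_n -> R),
      (forall i, a <= x i <= y i /\ y i <= b) ->
      (forall i j, i != j -> y i <= x j \/ y j <= x i) ->
      \sum_(i < n) (y i - x i) < r ->
      \sum_(i < n) normc (f (y i) - f (x i)) < e.

End ComplexValued.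

Section MatrixValued.
Context {R : realType} {d : nat}.
Local Notation mu := (@lebesgue_measure R).
Implicit Types (F G : R -> 'M[R[i]]_d) (D : set R).

Definition mxintegrable D F := forall i j, cintegrable D (fun x => F x i j).

Definition mxintegral D F : 'M[R[i]]_d :=
  \matrix_(i, j) cintegral D (fun x => F x i j).

(* All norms on matrices being equivalent, the sum of the moduli of the entries
   yields the topology of L^1. *)
Definition L1dist D F G : \bar R :=
  (\int[mu]_(x in D) (\sum_i \sum_j normc (F x i j - G x i j))%:E)%E.

Definition posdefmx (M : 'M[R[i]]_d) :=
  M \is hermsymmx /\
  forall x : 'cV[R[i]]_d, x != 0 -> 0 < (x ^t* *m M *m x) 0 0.

End MatrixValued.

(* Representatives of classes in L^1: every condition below is stated almost
   everywhere or through integrals, so it does not depend on the choice of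
   representatives. [Pinv] stands for P^-1; P itself need not exist. *)
Record coeffs (R : realType) (d : nat) := Coeffs {
  Pinv : R -> 'M[R[i]]_d ;
  Qmx : R -> 'M[R[i]]_d ;
  Wmx : R -> 'M[R[i]]_d }.

(* a = al 0 < be 0 < al 1 < be 1 < ... < al N < be N = b; the values of al and
   be beyond N are irrelevant. *)
Definition atkinson_partition (R : realType) (N : nat) (al be : nat -> R) :=
  (forall i, (i <= N)%N -> al i < be i) /\
  (forall i, (i < N)%N -> be i < al i.+1).

Section Omega.
Context {R : realType} {d : nat}.
Local Notation mu := (@lebesgue_measure R).
Variables (N : nat) (al be : nat -> R).

Definition null_on (D : set R) (F : R -> 'M[R[i]]_d) :=
  {ae mu, forall x, D x -> F x = 0}.

Definition hermitian_L1 (F : R -> 'M[R[i]]_d) :=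
  mxintegrable `]al 0%N, be N[ F /\
  {ae mu, forall x, x \in `]al 0%N, be N[ -> F x \is hermsymmx}.

Definition Omega : set (coeffs R d) := [set w |
  [/\ [/\ hermitian_L1 (Pinv w), hermitian_L1 (Qmx w) & hermitian_L1 (Wmx w)],
      forall i, (i <= N)%N ->
        null_on `[al i, be i] (Pinv w) /\
        posdefmx (mxintegral `[al i, be i] (Wmx w)) &
      forall j, (1 <= j <= N)%N ->
        [/\ null_on `[be j.-1, al j] (Qmx w),
            null_on `[be j.-1, al j] (Wmx w) &
            mxintegral `[be j.-1, al j] (Pinv w) \in unitmx]]].

Definition coeffs_dist (w w' : coeffs R d) : \bar R :=
  (L1dist `]al 0%N, be N[ (Pinv w) (Pinv w') +
   L1dist `]al 0%N, be N[ (Qmx w) (Qmx w') +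
   L1dist `]al 0%N, be N[ (Wmx w) (Wmx w'))%E.

Definition continuous_on_Omega (f : coeffs R d -> R) :=
  forall w, Omega w -> forall e : R, 0 < e -> exists2 r : R, 0 < r &
    forall w', Omega w' -> (coeffs_dist w w' < r%:E)%E -> `|f w' - f w| < e.

End Omega.

Section BoundaryConditions.
Context {R : realType} {d : nat}.
Local Notation C := R[i].

Definition self_adjoint_bc (A B : 'M[C]_(d + d)) :=
  \rank (row_mx A B) = (d + d)%N /\ A *m B ^t* = B *m A ^t*.

(* [A | B]: the orbit of (A, B) under left multiplication by GL(2d, C). *)
Definition bc_class (A B : 'M[C]_(d + d)) : set ('M[C]_(d + d) * 'M[C]_(d + d)) :=
  [set (T *m A, T *m B) | T in [set T | T \in unitmx]].

End BoundaryConditions.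

Section Spectrum.
Context {R : realType} {d : nat}.
Local Notation C := R[i].
Local Notation mu := (@lebesgue_measure R).
Variables (a b : R).
Implicit Types (w : coeffs R d) (lam : C).
Implicit Types (bA : set ('M[C]_(d + d) * 'M[C]_(d + d))).

Definition solution w lam (u v : R -> 'cV[C]_d) :=
  [/\ forall i, abs_continuous a b (fun x => u x i 0),
      forall i, abs_continuous a b (fun x => v x i 0),
      {ae mu, forall x, x \in `]a, b[ ->
        forall i, cis_derive x (fun t => u t i 0) ((Pinv w x *m v x) i 0)} &
      {ae mu, forall x, x \in `]a, b[ ->
        forall i, cis_derive x (fun t => v t i 0)
                    (((Qmx w x - lam *: Wmx w x) *m u x) i 0)}].

Definition satisfies_bc bA (u v : R -> 'cV[C]_d) := forall AB, bA AB ->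
  AB.1 *m col_mx (- u a) (u b) + AB.2 *m col_mx (v a) (v b) = 0.

Definition eigensolution w bA lam (uv : (R -> 'cV[C]_d) * (R -> 'cV[C]_d)) :=
  solution w lam uv.1 uv.2 /\ satisfies_bc bA uv.1 uv.2.

(* Only the values on [a, b] of a solution are meaningful. *)
Definition lin_indep k (uv : 'I_k -> (R -> 'cV[C]_d) * (R -> 'cV[C]_d)) :=
  forall c : 'I_k -> C,
    (forall x, x \in `[a, b] ->
       \sum_i c i *: (uv i).1 x = 0 /\ \sum_i c i *: (uv i).2 x = 0) ->
    forall i, c i = 0.

(* m is the maximal number of linearly independent eigensolutions for lam;
   lam is an eigenvalue iff m > 0. *)
Definition multiplicity w bA lam (m : nat) :=
  (exists uv : 'I_m -> _,
     (forall i, eigensolution w bA lam (uv i)) /\ lin_indep uv) /\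
  (forall uv : 'I_m.+1 -> _,
     (forall i, eigensolution w bA lam (uv i)) -> ~ lin_indep uv).

(* s lists all eigenvalues in nondecreasing order, repeated according to
   multiplicity; ranging over complex lam, it forces them to be real. *)
Definition eigenvalue_list w bA (s : seq R) :=
  sorted <=%R s /\
  forall lam, multiplicity w bA lam (count_mem lam [seq x%:C | x <- s]).

(* The list is unique when it exists, so the choice made by xget is immaterial. *)
Definition eigenvalues w bA : seq R := xget [::] (eigenvalue_list w bA).

Definition sharp1 w bA : nat := size (eigenvalues w bA).

(* Indexed from 1. *)
Definition lambda n bA w : R := nth 0 (eigenvalues w bA) n.-1.

End Spectrum.

(* Main.v *)
Require Import Defs.
From mathcomp Require Import all_boot all_order all_algebra.
From mathcomp Require Import complex.
From mathcomp Require Import all_classical all_reals all_analysis.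
From mathcomp Require Import perm measurable_realfun ring lra zify.
Import Order.TTheory GRing.Theory Num.Theory.
Import numFieldNormedType.Exports.
Import ComplexField.Normc.

(** An equation of Atkinson type hides a matrix pencil. Let (u, v) solve the
    system. On [al i, be i], where P^-1 vanishes, u is constant, say u i; on
    [be j, al j.+1], where Q and W vanish, v is constant, say v j.+1. With v 0 and
    v N.+1 the boundary values of v, integration over these intervals gives
      u j.+1 - u j = P_(j.+1) v j.+1   and   v i.+1 - v i = (Q_i - lam W_i) u i,
    where P_j, Q_i, W_i are the integrals of P^-1, Q, W. Conversely every solution
    of these equations comes from a unique (u, v): primitives of functions known in
    advance ([solution_nodes], [solution_exists], [solution_eq0]). The passage
    rests on the fundamental theorem of calculus for absolutely continuous
    functions ([abs_continuous_FTC]), hence on the fact that such a function with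
    almost everywhere zero derivative is constant ([rabs_continuous_const]).

    A self-adjoint boundary condition says that the pair x = (- u 0, u N) is of
    the form B^t* t and that z = (v 0, v N.+1) equals - A^t* t up to the orthogonal
    complement of the range of B^t*. The admissible (u i) therefore form a space V
    of dimension (N - 1) d + rank B that does not depend on the coefficients.
    Eliminating v by inverting the P_j and summing by parts turns the problem into
    H c = lam W c on V, with
      H : sum_i (u i)^t* Q_i (u i) + t^t* B A^t* t
            + sum_j (u j - u (j - 1))^t* P_j^-1 (u j - u (j - 1)),
      W : sum_i (u i)^t* W_i (u i)
    as Hermitian forms, the second one positive definite ([weak_form],
    [disc_system_kernel], [kernel_disc_system]). Diagonalising the pencil (H, W)
    lists the eigenvalues with their multiplicities ([pencil_diag_exists],
    [pencil_multiplicity]); there are dim V of them.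

    The matrices H and W depend continuously on the coefficients, because entries
    of P_j, Q_i, W_i move by at most a constant times the L^1 distance and matrix
    inversion is continuous ([tends_pencilH], [tends_pencilW]). The n-th eigenvalue
    of a Hermitian pencil with positive definite W depends continuously on the
    pencil: it is at most t exactly when H - t W is nonpositive on a space of
    dimension n ([pencil_eig_le], [pencil_eig_continuous]). *)

Set Implicit Arguments.
Unset Strict Implicit.
Unset Printing Implicit Defensive.

Local Open Scope classical_set_scope.
Local Open Scope ring_scope.
Local Open Scope complex_scope.
Local Open Scope sesquilinear_scope.


(** * Absolutely continuous functions with almost everywhere zero derivative *)
Section RealAC.
Context {R : realType}.
Local Notation mu := (@lebesgue_measure R).
Implicit Types (f g : R -> R).

(** Real-valued counterpart of [abs_continuous]; the latter amounts to this
    property for the real and for the imaginary part. *)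
Definition rabs_continuous (a b : R) f :=
  forall e : R, 0 < e -> exists2 r : R, 0 < r &
    forall (n : nat) (x y : 'I_n -> R),
      (forall i, a <= x i <= y i /\ y i <= b) ->
      (forall i j, i != j -> y i <= x j \/ y j <= x i) ->
      \sum_(i < n) (y i - x i) < r ->
      \sum_(i < n) `|f (y i) - f (x i)| < e.

(** The interval [x, z] surrounds t instead of starting there: the growth
    argument of [rabs_continuous_const] advances by intervals tagged by an
    interior point. *)
Lemma derive0_gauge f (t e : R) : is_derive t 1 f 0 -> 0 < e ->
  exists2 g, 0 < g & forall x z, x <= t <= z -> t - x < g -> z - t < g ->
    `|f z - f x| <= e * (z - x).
Proof.
move=> [df Df] e0.
have : (fun h : R => h^-1 *: ((f \o shift t) (h *: 1) - f t)) @ 0^' --> (0 : R).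
  by have := df; rewrite /derivable -/(derive f t 1) Df.
move=> /cvgrPdist_le /(_ _ e0) => -[g /= g0 gP].
have G h : `|h| < g -> `|f (h + t) - f t| <= e * `|h|.
  move=> hg; have [->|h0] := eqVneq h 0; first by rewrite add0r subrr !normr0 mulr0.
  have := gP h; rewrite /ball_ /= sub0r normrN => /(_ hg h0).
  rewrite sub0r normrN normrZ normfV ler_pdivrMl ?normr_gt0// [h *: 1]mulr1.
  by rewrite mulrC.
exists g => // x z /andP[xt tz] xg zg.
have := G (x - t); have := G (z - t).
rewrite !subrK ger0_norm ?subr_ge0// => /(_ zg) Gz.
rewrite ler0_norm ?subr_le0// opprB => /(_ xg) Gx.
have -> : f z - f x = (f z - f t) - (f x - f t) by lra.
by apply: le_trans (ler_normB _ _) _; lra.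
Qed.

Lemma open_gauge (U : set R) (t : R) : open U -> U t ->
  exists2 g, 0 < g & forall x z, x <= t <= z -> t - x < g -> z - t < g ->
    `[x, z] `<=` U.
Proof.
move=> oU Ut; have /nbhs_ballP[g /= g0 gU] := open_nbhs_nbhs (conj oU Ut).
exists g => // x z /andP[xt tz] xg zg y /=; rewrite in_itv/= => /andP[xy yz].
by apply: gU; rewrite /ball/= ltr_norml; apply/andP; split; lra.
Qed.

(** Points of zero derivative contribute increments at most e times the length;
    the other points lie in an open set U of measure less than the r that absolute
    continuity attaches to e, so that increments over non-overlapping
    intervals inside U add up to less than e. A supremum argument, in place of
    a covering theorem, shows that such a decomposition reaches from a to b. *)
Lemma rabs_continuous_const a b f : a <= b -> rabs_continuous a b f ->
  {ae mu, forall x, x \in `]a, b[ -> is_derive x 1 f 0} -> f b = f a.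
Proof.
move=> ab acf [M [mM M0 Mf]].
suff H e : 0 < e -> `|f b - f a| <= e * (b - a) + e.
  apply/eqP; rewrite -subr_eq0 -normr_le0; apply/ler_addgt0Pl => e e0.
  rewrite addr0; have ba : 0 < b - a + 1 by rewrite ltr_wpDl// subr_ge0.
  have := H (e / (b - a + 1)); rewrite divr_gt0// => /(_ isT) /le_trans; apply.
  by rewrite -[X in _ + X]mulr1 -mulrDr divfK// gt_eqF.
move=> e0; have [r r0 acr] := acf e e0.
pose M' := M `|` [set a] `|` [set b].
have mM' : measurable M' by apply: measurableU => //; exact: measurableU.
have M'0 : mu M' = 0.
  apply/negligibleP => //; apply: negligibleU; first apply: negligibleU.
  - exact/negligibleP.
  - by apply/negligibleP => //; exact: lebesgue_measure_set1.
  - by apply/negligibleP => //; exact: lebesgue_measure_set1.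
have [|U [oU M'U UM']] := lebesgue_regularity_outer mM' _ r0.
  by change (mu M' < +oo)%E; rewrite M'0.
have mU : measurable U by exact: open_measurable.
have muU : (mu U < r%:E)%E.
  suff UM0 : mu (U `&` M') = 0.
    have -> : mu U = (mu (U `\` M') + mu (U `&` M'))%E by exact: measureDI.
    by rewrite UM0 adde0.
  apply/eqP; rewrite eq_le measure_ge0 andbT -M'0; apply: le_measure => //;
    rewrite ?inE//; exact: measurableI.
have gauge t : a <= t <= b -> exists2 g, 0 < g &
    forall x z, x <= t <= z -> t - x < g -> z - t < g ->
    `|f z - f x| <= e * (z - x) \/ `[x, z] `<=` U.
  move=> /andP[at_ tb]; have [M't|nM't] := pselect (M' t).
    have [g g0 gP] := open_gauge oU (M'U _ M't).
    by exists g => // x z xtz xg zg; right; exact: gP.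
  have tE : t \in `]a, b[.
    rewrite in_itv/= !lt_neqAle at_ tb !andbT; apply/andP; split; apply/eqP => E.
      by apply: nM't; left; right; rewrite -E.
    by apply: nM't; right; rewrite E.
  have ft : is_derive t 1 f 0.
    by apply: contrapT => nft; apply: nM't; left; left; apply: Mf => /= /(_ tE).
  have [g g0 gP] := derive0_gauge ft e0.
  by exists g => // x z xtz xg zg; left; exact: gP.
(* G z: the growth of f from a to z is at most e * (z - a) plus the increments
   over a list of non-overlapping intervals, of total length at most the measure
   of U before z. *)
pose disj (p q : R * R) := (p.2 <= q.1) || (q.2 <= p.1).
pose G z := [/\ a <= z, z <= b & exists s : seq (R * R),
  [/\ forall p, p \in s -> [/\ a <= p.1, p.1 <= p.2 & p.2 <= z],
      pairwise disj s,
      ((\sum_(p <- s) (p.2 - p.1))%:E <= mu (U `&` `]a, z]))%E &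
      `|f z - f a| <= e * (z - a) + \sum_(p <- s) `|f p.2 - f p.1| ]].
have Ga : G a.
  split => //; exists [::]; split => //.
    by rewrite big_nil measure_ge0.
  by rewrite big_nil !subrr normr0 mulr0 addr0.
have Gstep x z : G x -> x <= z -> z <= b ->
    `|f z - f x| <= e * (z - x) \/ `[x, z] `<=` U -> G z.
  move=> [ax xb [s [s1 s2 s3 s4]]] xz zb.
  have E : U `&` `]a, z] = (U `&` `]a, x]) `|` (U `&` `]x, z]).
    by rewrite -setIUr -itv_bndbnd_setU// bnd_simp.
  have mUi (u v : R) : measurable (U `&` `]u, v]) by exact: measurableI.
  have mE : mu (U `&` `]a, z]) = (mu (U `&` `]a, x]) + mu (U `&` `]x, z]))%E.
    rewrite E; apply: measureU; [exact: mUi|exact: mUi|].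
    apply/seteqP; split => // y [[_ /=]]; rewrite !in_itv/= => /andP[_ yx] [_ /andP[xy _]].
    by move: (lt_le_trans xy yx); rewrite ltxx.
  case=> [fxz|xzU]; (split => //; first exact: le_trans xz).
    exists s; split => //.
    - by move=> p /s1[? ? px]; split => //; exact: le_trans px xz.
    - by apply: le_trans s3 _; rewrite mE leeDl// measure_ge0.
    - have -> : f z - f a = (f z - f x) + (f x - f a) by lra.
      by apply: le_trans (ler_normD _ _) _; lra.
  exists ((x, z) :: s); split => //=.
  - move=> p; rewrite inE => /predU1P[->//|/s1[? ? px]]; split => //.
    exact: le_trans px xz.
  - rewrite s2 andbT; apply/allP => p /s1[_ _ px]; by rewrite /disj /= px orbT.
  - rewrite big_cons /= mE EFinD addeC; apply: leeD => //.
    have -> : U `&` `]x, z] = `]x, z]%classic.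
      apply/setIidPr; apply: subset_trans xzU; exact: subset_itv_oc_cc.
    rewrite lebesgue_measure_itv/= lte_fin; case: ltP => [_|zx]; first by rewrite -EFinD.
    by rewrite lee_fin subr_le0.
  - rewrite big_cons /=.
    have -> : f z - f a = (f z - f x) + (f x - f a) by lra.
    apply: le_trans (ler_normD _ _) _.
    have : e * (x - a) <= e * (z - a) by rewrite ler_pM2l//; lra.
    lra.
have hsG : has_sup [set z | G z].
  by split; [exists a|exists b => z /= -[]].
pose s := sup [set z | G z].
have as_ : a <= s by apply: (ub_le_sup hsG.2) => /=.
have sb : s <= b by apply: (ge_sup hsG.1) => z /= [].
have [|g g0 gP] := gauge s; first by rewrite as_.
have [x /= Gx xs] := sup_adherent g0 hsG.
have xls : x <= s by exact: (ub_le_sup hsG.2).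
pose z := Num.min b (s + g / 2).
have sz : s <= z by rewrite le_min sb /= lerDl divr_ge0// ltW.
have zb : z <= b by rewrite ge_min lexx.
have Gz : G z.
  apply: (Gstep x) => //; first exact: le_trans sz.
  apply: gP; first (by rewrite xls sz); first by rewrite -/s in xs; lra.
  have : z <= s + g / 2 by rewrite ge_min lexx orbT.
  lra.
have zs : z <= s by exact: (ub_le_sup hsG.2).
have {zs sz} zE : z = b.
  move: zs; rewrite /z minEle; case: ifP => // _ zs; exfalso; lra.
move: Gz; rewrite zE => -[_ _ [l [l1 l2 l3 l4]]].
apply: le_trans l4 _; rewrite lerD2l; apply: ltW.
pose X (i : 'I_(size l)) := (nth (0, 0) l i).1.
pose Y (i : 'I_(size l)) := (nth (0, 0) l i).2.
have sumE (F : R -> R -> R) : \sum_(p <- l) F p.1 p.2 = \sum_(i < size l) F (X i) (Y i).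
  by rewrite (big_nth (0, 0)) big_mkord.
rewrite (sumE (fun u v => `|f v - f u|)); apply: acr.
- move=> i; have [] := l1 (nth (0, 0) l i); first exact: mem_nth.
  by move=> -> ->; split.
- have dl i j : (i < j < size l)%N -> disj (nth (0, 0) l i) (nth (0, 0) l j).
    move=> /andP[ij js]; apply: (pairwiseP (0, 0) l2) => //.
    by rewrite inE (ltn_trans ij).
  move=> i j; rewrite neq_ltn => /orP[] ij.
    have /dl/orP[] // : (i < j < size l)%N by rewrite ij ltn_ord.
      by left.
    by right.
  have /dl/orP[] // : (j < i < size l)%N by rewrite ij ltn_ord.
    by right.
  by left.
- rewrite -(sumE (fun u v => v - u)) -lte_fin; apply: le_lt_trans l3 _.
  apply: le_lt_trans muU; apply: le_measure; rewrite ?inE//.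
    exact: measurableI.
Qed.

End RealAC.


(** * Primitives of integrable functions and the fundamental theorem *)
Section RealPrimitive.
Context {R : realType}.
Local Notation mu := (@lebesgue_measure R).
Implicit Types (f g : R -> R).

Lemma aeS (P Q : R -> Prop) : (forall x, P x -> Q x) ->
  {ae mu, forall x, P x} -> {ae mu, forall x, Q x}.
Proof. by move=> PQ; apply: filterS => //; exact: (ae_filter_ringOfSetsType mu). Qed.

Lemma aeI (P Q : R -> Prop) : {ae mu, forall x, P x} -> {ae mu, forall x, Q x} ->
  {ae mu, forall x, P x /\ Q x}.
Proof. by apply: filterI; exact: (ae_filter_ringOfSetsType mu). Qed.

Lemma rabs_continuousS (a b c d : R) f : a <= c -> d <= b ->
  rabs_continuous a b f -> rabs_continuous c d f.
Proof.
move=> ac db acf e e0; have [r r0 rP] := acf e e0; exists r => // n x y xy.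
apply: rP => i; have [/andP[cx ->] yd] := xy i.
by split; [rewrite (le_trans ac cx)|exact: le_trans db].
Qed.

Lemma rabs_continuous_lin (a b p q : R) f g :
  rabs_continuous a b f -> rabs_continuous a b g ->
  rabs_continuous a b (fun x => p * f x + q * g x).
Proof.
move=> acf acg e e0.
(* The summand 1 keeps the quotient meaningful for a zero coefficient. *)
have E (t : R) : 0 < e / (2 * (`|t| + 1)) by rewrite divr_gt0// mulr_gt0// ltr_wpDl.
have [r1 r10 r1P] := acf _ (E p); have [r2 r20 r2P] := acg _ (E q).
exists (Num.min r1 r2); first by rewrite lt_min r10.
move=> n x y xy dis; rewrite lt_min => /andP[lt1 lt2].
have {}r1P := r1P _ _ _ xy dis lt1; have {}r2P := r2P _ _ _ xy dis lt2.
have K (t S : R) : 0 <= S -> S < e / (2 * (`|t| + 1)) -> `|t| * S < e / 2.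
  move=> S0; rewrite invfM mulrA ltr_pdivlMr ?ltr_wpDl// mulrDr mulr1 [S * _]mulrC.
  by lra.
apply: le_lt_trans (_ : \sum_(i < n) (`|p| * `|f (y i) - f (x i)| +
   `|q| * `|g (y i) - g (x i)|) < e).
  apply: ler_sum => i _; rewrite -!normrM; apply: le_trans _ (ler_normD _ _).
  by rewrite le_eqVlt; apply/orP; left; apply/eqP; congr (`| _ |); ring.
rewrite big_split /= -!mulr_sumr.
have := K p _ _ r1P; rewrite sumr_ge0// => /(_ isT).
have := K q _ _ r2P; rewrite sumr_ge0// => /(_ isT).
by lra.
Qed.

Lemma integrable_itv_oo_cc (a b : R) g : mu.-integrable `]a, b[ (EFin \o g) ->
  mu.-integrable `[a, b] (EFin \o g).
Proof.
move=> /integrableP[mg ig].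
have mg' : measurable_fun `[a, b] (EFin \o g) by exact: emeasurable_fun_itv_cc mg.
apply/integrableP; split => //.
rewrite -integral_itv_bndo_bndc; last first.
  apply: measurableT_comp => //.
  apply: measurable_funS mg' => //; exact: subset_itv_co_cc.
rewrite -integral_itv_obnd_cbnd//.
by apply: measurableT_comp.
Qed.

(** Based at -oo, so that one primitive serves every subinterval; only its
    increments matter. *)
Definition prim g (x : R) : R := \int[mu]_(t in `]-oo, x]) g t.

Lemma primB g x y : mu.-integrable setT (EFin \o g) -> x <= y ->
  prim g y - prim g x = \int[mu]_(t in `]x, y]) g t.
Proof.
move=> ig xy; apply: Rintegral_itvB => //.
by apply: integrableS ig.
Qed.

Lemma prim_derive g : mu.-integrable setT (EFin \o g) ->
  {ae mu, forall x : R, is_derive x 1 (prim g) (g x)}.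
Proof.
move=> ig; have : {ae mu, forall x : R, derivable (prim g) x 1 /\ derive1 (prim g) x = g x}.
  apply: FTC1Ny; first by move=> y; apply: integrableS ig.
  by apply: open_integrable_locally => //; exact: openT.
apply: aeS => x [dx <-]; rewrite derive1E; exact/derivableP.
Qed.

(** The increments over non-overlapping intervals are bounded by the integral of
    |g| over their union, which is small because the union has small measure. *)
Lemma prim_abs_continuous (a b : R) g : mu.-integrable setT (EFin \o g) ->
  rabs_continuous a b (prim g).
Proof.
move=> ig e e0; have [r [r0 rP]] := integral_normr_continuous ig e0.
exists r => // n x y xy dis sr.
pose F (i : 'I_n) : set (measurableTypeR R) := `]x i, y i]%classic.
have mF i : measurable (F i) by exact: measurable_itv.
have tF : trivIset setT F.
  apply/trivIsetP => i j _ _ ij; apply/seteqP; split => // t [].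
  rewrite /F /= !in_itv /= => /andP[xi yi] /andP[xj yj].
  by have [] := dis i j ij => h; lra.
pose D : set (measurableTypeR R) := \big[setU/set0]_(i < n) F i.
have mD : measurable D by exact: bigsetU_measurable.
have muD : (mu D < r%:E)%E.
  have -> : mu D = (\sum_(i < n) mu (F i))%E by apply: measure_semi_additive_ord.
  rewrite -lte_fin in sr; apply: le_lt_trans sr; rewrite -sumEFin.
  apply: lee_sum => i _; rewrite lebesgue_measure_itv /= lte_fin.
  have [/andP[_ xi] _] := xy i; case: ltP => _; rewrite ?lee_fin ?subr_ge0//.
apply: le_lt_trans (rP _ mD muD).
have ig' : mu.-integrable setT (EFin \o (fun t => `|g t|)).
  exact: (integrable_abse ig).
have igF i : mu.-integrable (F i) (EFin \o g) by exact: (integrableS measurableT (mF i) (@subsetT _ _) ig).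
have igF' i : mu.-integrable (F i) (EFin \o (fun t => `|g t|)) by exact: (integrableS measurableT (mF i) (@subsetT _ _) ig').
have -> : \int[mu]_(t in D) `|g t| = \sum_(i < n) \int[mu]_(t in F i) `|g t|.
  rewrite /Rintegral /D integral_bigsetU_EFin//.
  - by rewrite sum_fine// => i _; exact: integrable_fin_num.
  - by rewrite /index_enum -enumT; exact: enum_uniq.
  - by apply: sub_trivIset tF.
  - by case/integrableP: ig' => mg _; exact: measurable_funS mg.
apply: ler_sum => i _; rewrite primB//; last by have [/andP[_]] := xy i.
exact: (le_normr_Rintegral (mF i) (igF i)).
Qed.

End RealPrimitive.

Section ComplexPrimitive.
Context {R : realType}.
Local Notation mu := (@lebesgue_measure R).
Local Notation C := R[i].
Implicit Types (f g : R -> C).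

Lemma normc_le (z : C) : normc z <= `|complex.Re z| + `|complex.Im z|.
Proof.
case: z => x y /=; rewrite -[leRHS]ger0_norm ?addr_ge0// -sqrtr_sqr.
rewrite ler_sqrt ?sqr_ge0// sqrrD !real_normK ?num_real//.
by rewrite lerD2r lerDl mulrn_wge0// mulr_ge0.
Qed.

Lemma normRe_le (z : C) : `|complex.Re z| <= normc z.
Proof. by case: z => x y /=; rewrite -sqrtr_sqr ler_sqrt ?lerDl ?sqr_ge0// addr_ge0// sqr_ge0. Qed.

Lemma normIm_le (z : C) : `|complex.Im z| <= normc z.
Proof. by case: z => x y /=; rewrite -sqrtr_sqr ler_sqrt ?lerDr ?sqr_ge0// addr_ge0// sqr_ge0. Qed.

Lemma abs_continuousP (a b : R) f : abs_continuous a b f <->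
  rabs_continuous a b (fun x => complex.Re (f x)) /\
  rabs_continuous a b (fun x => complex.Im (f x)).
Proof.
split=> [acf|[acr aci]].
  split=> e e0; have [r r0 rP] := acf e e0; exists r => // n x y xy dis sr;
    apply: le_lt_trans (rP n x y xy dis sr); apply: ler_sum => i _;
    rewrite -raddfB /=; [exact: normRe_le|exact: normIm_le].
move=> e e0; have e2 : 0 < e / 2 by rewrite divr_gt0.
have [r1 r10 r1P] := acr _ e2; have [r2 r20 r2P] := aci _ e2.
exists (Num.min r1 r2); first by rewrite lt_min r10.
move=> n x y xy dis; rewrite lt_min => /andP[/(r1P _ _ _ xy dis) lt1 /(r2P _ _ _ xy dis) lt2].
apply: le_lt_trans (_ : \sum_(i < n) (`|complex.Re (f (y i)) - complex.Re (f (x i))| +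
   `|complex.Im (f (y i)) - complex.Im (f (x i))|) < e); last by rewrite big_split /=; lra.
by apply: ler_sum => i _; rewrite -!raddfB; exact: normc_le.
Qed.

Lemma abs_continuousS (a b c d : R) f : a <= c -> d <= b ->
  abs_continuous a b f -> abs_continuous c d f.
Proof.
by move=> ac db /abs_continuousP[acr aci]; apply/abs_continuousP;
  split; apply: rabs_continuousS ac db _.
Qed.

Lemma ReM (z w : C) : complex.Re (z * w) = complex.Re z * complex.Re w - complex.Im z * complex.Im w.
Proof. by case: z w => [? ?] [? ?]. Qed.

Lemma ImM (z w : C) : complex.Im (z * w) = complex.Re z * complex.Im w + complex.Im z * complex.Re w.
Proof. by case: z w => [? ?] [? ?]. Qed.

Lemma abs_continuousD (a b : R) f g : abs_continuous a b f -> abs_continuous a b g ->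
  abs_continuous a b (fun x => f x + g x).
Proof.
move=> /abs_continuousP[fr fi] /abs_continuousP[gr gi]; apply/abs_continuousP; split.
  have := rabs_continuous_lin 1 1 fr gr; congr rabs_continuous.
  by apply/funext => x; rewrite raddfD /= !mul1r.
have := rabs_continuous_lin 1 1 fi gi; congr rabs_continuous.
by apply/funext => x; rewrite raddfD /= !mul1r.
Qed.

Lemma abs_continuousZ (a b : R) (k : C) f : abs_continuous a b f ->
  abs_continuous a b (fun x => k * f x).
Proof.
move=> /abs_continuousP[fr fi]; apply/abs_continuousP; split.
  have := rabs_continuous_lin (complex.Re k) (- complex.Im k) fr fi; congr rabs_continuous.
  by apply/funext => x; rewrite ReM mulNr.
have := rabs_continuous_lin (complex.Re k) (complex.Im k) fi fr; congr rabs_continuous.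
by apply/funext => x; rewrite ImM.
Qed.

Lemma abs_continuous_cst (a b : R) (k : C) : abs_continuous a b (fun=> k).
Proof.
by move=> e e0; exists 1 => // n x y _ _ _; rewrite big1// => i _; rewrite subrr normc0.
Qed.

Lemma abs_continuous_sum (a b : R) n (f : 'I_n -> R -> C) :
  (forall i, abs_continuous a b (f i)) -> abs_continuous a b (fun x => \sum_i f i x).
Proof.
elim: n f => [|n IH] f acf.
  have := @abs_continuous_cst a b 0; congr abs_continuous.
  by apply/funext => x; rewrite big_ord0.
have := abs_continuousD (IH _ (fun i => acf (widen_ord (leqnSn n) i))) (acf ord_max).
by congr abs_continuous; apply/funext => x; rewrite big_ord_recr.
Qed.

Lemma cis_deriveD (x : R) f g k l : cis_derive x f k -> cis_derive x g l ->
  cis_derive x (fun t => f t + g t) (k + l).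
Proof.
move=> [fr fi] [gr gi]; split.
  have := is_deriveD fr gr; rewrite raddfD; congr is_derive.
  by apply/funext => t; rewrite raddfD.
have := is_deriveD fi gi; rewrite raddfD; congr is_derive.
by apply/funext => t; rewrite raddfD.
Qed.

Lemma cis_deriveZ (x : R) (c : C) f k : cis_derive x f k ->
  cis_derive x (fun t => c * f t) (c * k).
Proof.
move=> [fr fi]; split.
  have := is_deriveB (is_deriveZ (complex.Re c) fr) (is_deriveZ (complex.Im c) fi).
  rewrite ReM; congr is_derive.
  by apply/funext => t; rewrite ReM.
have := is_deriveD (is_deriveZ (complex.Re c) fi) (is_deriveZ (complex.Im c) fr).
rewrite ImM; congr is_derive.
by apply/funext => t; rewrite ImM.
Qed.

Lemma cis_derive_cst (x : R) (k : C) : cis_derive x (fun=> k) 0.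
Proof. by split; exact: is_derive_cst. Qed.

Lemma cis_derive_sum (x : R) n (f : 'I_n -> R -> C) (k : 'I_n -> C) :
  (forall i, cis_derive x (f i) (k i)) -> cis_derive x (fun t => \sum_i f i t) (\sum_i k i).
Proof.
elim: n f k => [|n IH] f k df.
  have := cis_derive_cst x 0; rewrite big_ord0; congr cis_derive.
  by apply/funext => t; rewrite big_ord0.
have := cis_deriveD (IH _ _ (fun i => df (widen_ord (leqnSn n) i))) (df ord_max).
by rewrite [in X in _ -> X]big_ord_recr; congr cis_derive; apply/funext => t; rewrite big_ord_recr.
Qed.

Definition cprim g x : C := prim (fun t => complex.Re (g t)) x +i* prim (fun t => complex.Im (g t)) x.

Lemma cprim_abs_continuous (a b : R) g : cintegrable setT g -> abs_continuous a b (cprim g).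
Proof. by move=> [gr gi]; apply/abs_continuousP; split; exact: prim_abs_continuous. Qed.

Lemma cprim_derive g : cintegrable setT g -> {ae mu, forall x : R, cis_derive x (cprim g) (g x)}.
Proof. by move=> [gr gi]; have := aeI (prim_derive gr) (prim_derive gi). Qed.

Lemma cprimB g x y : cintegrable setT g -> x <= y ->
  cprim g y - cprim g x = cintegral `[x, y] g.
Proof.
move=> [gr gi] xy; rewrite /cprim /cintegral.
rewrite -!Rintegral_itv_obnd_cbnd; [|exact: integrableS gi|exact: integrableS gr].
by rewrite -!primB//.
Qed.

Lemma abs_continuous_const (a b : R) f : a <= b -> abs_continuous a b f ->
  {ae mu, forall x, x \in `]a, b[ -> cis_derive x f 0} -> f b = f a.
Proof.
move=> ab /abs_continuousP[fr fi] df.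
have Er : complex.Re (f b) = complex.Re (f a).
  by apply: (rabs_continuous_const ab fr); apply: aeS df => x h /h[].
have Ei : complex.Im (f b) = complex.Im (f a).
  by apply: (rabs_continuous_const ab fi); apply: aeS df => x h /h[].
by move: Er Ei; case: (f a) => ? ?; case: (f b) => ? ? /= -> ->.
Qed.

Lemma cintegrable_oo_cc (a b : R) g : cintegrable `]a, b[ g -> cintegrable `[a, b] g.
Proof. by move=> [gr gi]; split; exact: integrable_itv_oo_cc. Qed.

Lemma cintegrableS (D E : set (measurableTypeR R)) g : measurable D -> measurable E ->
  E `<=` D -> cintegrable D g -> cintegrable E g.
Proof. by move=> mD mE ED [gr gi]; split; [exact: integrableS gr|exact: integrableS gi]. Qed.

Lemma cintegrable_patch (D : set (measurableTypeR R)) g : measurable D -> cintegrable D g ->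
  cintegrable setT (fun x => if x \in D then g x else 0).
Proof.
move=> mD [/(integrable_mkcond _ mD) gr /(integrable_mkcond _ mD) gi]; split.
  by apply: eq_integrable gr => // x _; rewrite /patch /=; case: ifP.
by apply: eq_integrable gi => // x _; rewrite /patch /=; case: ifP.
Qed.

Lemma eq_cintegral (D : set R) f g : {in D, f =1 g} -> cintegral D f = cintegral D g.
Proof. by move=> fg; congr (_ +i* _); apply: eq_Rintegral => x /fg ->. Qed.

(** f and the primitive of g have the same derivative almost everywhere, so that
    their difference is constant by [abs_continuous_const]. *)
Lemma abs_continuous_FTC (a b : R) f g : a <= b -> abs_continuous a b f ->
  cintegrable `[a, b] g ->
  {ae mu, forall x, x \in `]a, b[ -> cis_derive x f (g x)} ->
  f b - f a = cintegral `[a, b] g.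
Proof.
move=> ab acf ig df.
(* g is only integrable on [a, b]; its primitive is that of its extension by 0. *)
pose h x := if x \in `[a, b]%classic then g x else 0.
have ih : cintegrable setT h by exact: cintegrable_patch.
have -> : cintegral `[a, b] g = cintegral `[a, b] h.
  by apply: eq_cintegral => x; rewrite /h => ->.
rewrite -cprimB//.
have ach := abs_continuousZ (-1) (cprim_abs_continuous a b ih).
have := abs_continuous_const ab (abs_continuousD acf ach) _.
suff H : {ae mu, forall x, x \in `]a, b[ -> cis_derive x (fun t => f t + -1 * cprim h t) 0}.
  move=> /(_ H); rewrite !mulN1r => E.
  by apply/eqP; rewrite subr_eq addrAC -addrA -E addrCA subrr addr0.
apply: aeS (aeI df (cprim_derive ih)) => x [dfx dhx] xab.
have := cis_deriveD (dfx xab) (cis_deriveZ (-1) dhx); congr cis_derive.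
rewrite /h mem_set ?mulN1r ?subrr//.
by apply: subset_itv_oo_cc.
Qed.

Lemma cintegrableD (D : set (measurableTypeR R)) f g : measurable D ->
  cintegrable D f -> cintegrable D g -> cintegrable D (fun x => f x + g x).
Proof.
move=> mD [fr fi] [gr gi]; split.
  by apply: eq_integrable (integrableD mD fr gr) => // x _; rewrite /= raddfD.
by apply: eq_integrable (integrableD mD fi gi) => // x _; rewrite /= raddfD.
Qed.

Lemma cintegrableZ (D : set (measurableTypeR R)) (k : C) g : measurable D ->
  cintegrable D g -> cintegrable D (fun x => k * g x).
Proof.
move=> mD [gr gi]; split.
  have := integrableD mD (integrableZl mD (complex.Re k) gr) (integrableZl mD (- complex.Im k) gi).
  by apply: eq_integrable => // x _; rewrite /= -!EFinM -EFinD ReM mulNr.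
have := integrableD mD (integrableZl mD (complex.Re k) gi) (integrableZl mD (complex.Im k) gr).
by apply: eq_integrable => // x _; rewrite /= ImM.
Qed.

Lemma cintegrable_sum (D : set (measurableTypeR R)) n (f : 'I_n -> R -> C) : measurable D ->
  (forall i, cintegrable D (f i)) -> cintegrable D (fun x => \sum_i f i x).
Proof.
move=> mD; elim: n f => [|n IH] f fi.
  rewrite (_ : (fun x => _) = cst 0); first by split; exact: integrable0.
  by apply/funext => x; rewrite big_ord0.
have := cintegrableD mD (IH _ (fun i => fi (widen_ord (leqnSn n) i))) (fi ord_max).
by congr cintegrable; apply/funext => x; rewrite big_ord_recr.
Qed.

Lemma cintegralD (D : set (measurableTypeR R)) f g : measurable D ->
  cintegrable D f -> cintegrable D g ->
  cintegral D (fun x => f x + g x) = cintegral D f + cintegral D g.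
Proof.
move=> mD [fr fi] [gr gi]; rewrite /cintegral.
have -> (p q r s : R) : (p +i* q) + (r +i* s) = (p + r) +i* (q + s) by [].
rewrite -!RintegralD//.
by congr (_ +i* _); apply: eq_Rintegral => x _; rewrite raddfD.
Qed.

Lemma cintegralZ (D : set (measurableTypeR R)) (k : C) g : measurable D ->
  cintegrable D g -> cintegral D (fun x => k * g x) = k * cintegral D g.
Proof.
move=> mD [gr gi]; rewrite /cintegral.
case: k => p q; rewrite /=.
have -> (r s : R) : (p +i* q) * (r +i* s) = (p * r - q * s) +i* (p * s + q * r) by [].
have ip r h : mu.-integrable D (EFin \o h) -> mu.-integrable D (EFin \o (fun x => r * h x)).
  by move=> /(integrableZl mD r).
congr (_ +i* _).
  rewrite -!RintegralZl// -RintegralB; [|by []|exact: ip|exact: ip].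
  by apply: eq_Rintegral => x _; rewrite ReM.
rewrite -!RintegralZl// -RintegralD; [|by []|exact: ip|exact: ip].
by apply: eq_Rintegral => x _; rewrite ImM.
Qed.

Lemma cintegral_sum (D : set (measurableTypeR R)) n (f : 'I_n -> R -> C) : measurable D ->
  (forall i, cintegrable D (f i)) ->
  cintegral D (fun x => \sum_i f i x) = \sum_i cintegral D (f i).
Proof.
move=> mD; elim: n f => [|n IH] f fi.
  rewrite big_ord0 (_ : (fun x => _) = cst 0); last by apply/funext => x; rewrite big_ord0.
  by rewrite /cintegral /= !Rintegral_cst// !mul0r.
rewrite [RHS]big_ord_recr /= -(IH _ (fun i => fi _)) -cintegralD//.
  by congr cintegral; apply/funext => x; rewrite big_ord_recr.
by apply: cintegrable_sum => // i.
Qed.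

End ComplexPrimitive.


(** * Hermitian forms over the complex numbers *)
Section Adjoint.
Context {R : realType}.
Local Notation C := R[i].

Lemma adjM m n p (A : 'M[C]_(m, n)) (B : 'M[C]_(n, p)) :
  (A *m B) ^t* = B ^t* *m A ^t*.
Proof. by rewrite trmx_mul map_mxM. Qed.

Lemma adjD m n (A B : 'M[C]_(m, n)) : (A + B) ^t* = A ^t* + B ^t*.
Proof. by rewrite linearD map_mxD. Qed.

Lemma adjB m n (A B : 'M[C]_(m, n)) : (A - B) ^t* = A ^t* - B ^t*.
Proof. by rewrite linearB map_mxB. Qed.

Lemma adj_sum m n I (r : seq I) (P : pred I) (F : I -> 'M[C]_(m, n)) :
  (\sum_(i <- r | P i) F i) ^t* = \sum_(i <- r | P i) (F i) ^t*.
Proof. by rewrite linear_sum map_mx_sum. Qed.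

Lemma adj1 n : (1%:M : 'M[C]_n) ^t* = 1%:M.
Proof. by rewrite trmx1 map_mx1. Qed.

Lemma adj_inv n (A : 'M[C]_n) : (invmx A) ^t* = invmx (A ^t*).
Proof. by rewrite trmx_inv map_invmx. Qed.

Lemma adj_unit n (A : 'M[C]_n) : (A ^t* \in unitmx) = (A \in unitmx).
Proof. by rewrite map_unitmx unitmx_tr. Qed.

Lemma hermsymmxE n (A : 'M[C]_n) : (A \is hermsymmx) = (A ^t* == A).
Proof.
apply/is_hermitianmxP/eqP; rewrite expr0 scale1r; first by move=> {2}->.
by move=> ->.
Qed.

Lemma conjM_normc (z : C) : Num.conj z * z = (normc z ^+ 2)%:C.
Proof. by rewrite mulrC -normCK rmorphXn. Qed.

Lemma normc_ge0 (z : C) : 0 <= normc z.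
Proof. by case: z => a b; exact: sqrtr_ge0. Qed.

Lemma normc_conj (z : C) : normc (Num.conj z) = normc z.
Proof. by case: z => a b /=; rewrite sqrrN. Qed.

Lemma normcD (z w : C) : normc (z + w) <= normc z + normc w.
Proof. exact: le_normcD. Qed.

Lemma normc_sum I (r : seq I) (P : pred I) (F : I -> C) :
  normc (\sum_(i <- r | P i) F i) <= \sum_(i <- r | P i) normc (F i).
Proof.
elim/big_rec2: _ => [|i x y _ h]; first by rewrite normc0.
by apply: le_trans (normcD _ _) _; rewrite lerD2l.
Qed.

Lemma ReD (z w : C) : complex.Re (z + w) = complex.Re z + complex.Re w.
Proof. by case: z w => [? ?] [? ?]. Qed.

Lemma ReZ (r : R) (z : C) : complex.Re (r%:C * z) = r * complex.Re z.
Proof. by case: z => ? ?; rewrite /= mul0r subr0. Qed.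

Definition sqn n (x : 'cV[C]_n) : R := \sum_i normc (x i 0) ^+ 2.

Definition qf n (M : 'M[C]_n) (x : 'cV[C]_n) : C := (x ^t* *m M *m x) 0 0.

Lemma qfD n (M M' : 'M[C]_n) x : qf (M + M') x = qf M x + qf M' x.
Proof. by rewrite /qf mulmxDr mulmxDl mxE. Qed.

Lemma qfZ n k (M : 'M[C]_n) x : qf (k *: M) x = k * qf M x.
Proof. by rewrite /qf -scalemxAr -scalemxAl mxE. Qed.

Lemma qf_cong m n (M : 'M[C]_n) (S : 'M[C]_(n, m)) x : qf (S ^t* *m M *m S) x = qf M (S *m x).
Proof. by rewrite /qf adjM !mulmxA. Qed.

Definition rdiag n (l : 'I_n -> R) : 'M[C]_n := diag_mx (\row_i (l i)%:C).

Lemma rdiag_adj n (l : 'I_n -> R) : (rdiag l) ^t* = rdiag l.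
Proof.
rewrite /rdiag tr_diag_mx map_diag_mx; congr diag_mx.
by apply/rowP => i; rewrite !mxE; exact: conjc_real.
Qed.

Lemma rdiag_mulE m n (l : 'I_n -> R) (X : 'M[C]_(n, m)) i j :
  (rdiag l *m X) i j = (l i)%:C * X i j.
Proof. by rewrite mul_diag_mx !mxE. Qed.

Lemma rdiagM n (l l' : 'I_n -> R) : rdiag l *m rdiag l' = rdiag (fun i => l i * l' i).
Proof. by apply/matrixP => i j; rewrite rdiag_mulE !mxE mulrnAr rmorphM. Qed.

Lemma qf_rdiag n (l : 'I_n -> R) x : qf (rdiag l) x = (\sum_i l i * normc (x i 0) ^+ 2)%:C.
Proof.
rewrite /qf -mulmxA mxE rmorph_sum; apply: eq_bigr => i _.
rewrite [RHS]rmorphM /rdiag mul_diag_mx !mxE mulrCA; congr (_ * _); exact: conjM_normc.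
Qed.

Lemma sqn_ge0 n (x : 'cV[C]_n) : 0 <= sqn x.
Proof. by apply: sumr_ge0 => i _; rewrite sqr_ge0. Qed.

Lemma sqn_gt0 n (x : 'cV[C]_n) : x != 0 -> 0 < sqn x.
Proof.
move=> x0; rewrite lt_neqAle sqn_ge0 andbT eq_sym /sqn psumr_eq0; last by move=> i _; exact: sqr_ge0.
apply: contra x0 => /allP h; apply/eqP/colP => i.
have := h i; rewrite mem_index_enum /= sqrf_eq0 => /(_ isT)/eqP /eq0_normc ->.
by rewrite mxE.
Qed.

Lemma qf1 n (x : 'cV[C]_n) : qf 1%:M x = (sqn x)%:C.
Proof.
rewrite /qf mulmx1 mxE rmorph_sum; apply: eq_bigr => i _.
rewrite !mxE; exact: conjM_normc.
Qed.

Lemma qf_gram m n (S : 'M[C]_(n, m)) x : qf (S ^t* *m S) x = (sqn (S *m x))%:C.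
Proof. by rewrite -qf1 -qf_cong mulmx1. Qed.

Definition mxn m n (E : 'M[C]_(m, n)) : R := \sum_i \sum_j normc (E i j).

Lemma mxn_ge0 m n (E : 'M[C]_(m, n)) : 0 <= mxn E.
Proof. by apply: sumr_ge0 => i _; apply: sumr_ge0 => j _; exact: normc_ge0. Qed.

Lemma mxnD m n (E F : 'M[C]_(m, n)) : mxn (E + F) <= mxn E + mxn F.
Proof.
rewrite /mxn -big_split; apply: ler_sum => i _; rewrite -big_split; apply: ler_sum => j _.
by rewrite mxE; exact: normcD.
Qed.

Lemma mxnZ m n k (E : 'M[C]_(m, n)) : mxn (k *: E) = normc k * mxn E.
Proof.
rewrite /mxn mulr_sumr; apply: eq_bigr => i _; rewrite mulr_sumr; apply: eq_bigr => j _.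
by rewrite mxE normcM.
Qed.

Lemma mxnN m n (E : 'M[C]_(m, n)) : mxn (- E) = mxn E.
Proof. by rewrite -scaleN1r mxnZ normcN normc1 mul1r. Qed.

Lemma mxnM m n p (E : 'M[C]_(m, n)) (F : 'M[C]_(n, p)) : mxn (E *m F) <= mxn E * mxn F.
Proof.
rewrite /mxn mulr_suml; apply: ler_sum => i _.
apply: le_trans (_ : \sum_j \sum_k normc (E i k) * normc (F k j) <= _).
  apply: ler_sum => j _; rewrite mxE; apply: le_trans (normc_sum _ _ _) _.
  by apply: ler_sum => k _; rewrite normcM.
rewrite exchange_big mulr_suml; apply: ler_sum => k _.
rewrite -mulr_sumr; apply: ler_wpM2l; first exact: normc_ge0.
rewrite [leRHS](bigD1 k)//= lerDl; apply: sumr_ge0 => q _; apply: sumr_ge0 => j _.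
exact: normc_ge0.
Qed.

Lemma normc_le_sqn n (x : 'cV[C]_n) i j : normc (x i 0) * normc (x j 0) <= sqn x.
Proof.
have le1 k : normc (x k 0) ^+ 2 <= sqn x.
  by rewrite /sqn (bigD1 k)//= lerDl sumr_ge0// => l _; rewrite sqr_ge0.
have [ij|ij] := leP (normc (x i 0)) (normc (x j 0)).
  apply: le_trans (le1 j); rewrite expr2 ler_wpM2r//; exact: normc_ge0.
by apply: le_trans (le1 i); rewrite expr2 ler_wpM2l ?(ltW ij)//; exact: normc_ge0.
Qed.

(** Each product of two coordinates has modulus at most [sqn x]; this crude bound
    lets entrywise estimates control quadratic forms. *)
Lemma qf_bound n (E : 'M[C]_n) x : normc (qf E x) <= mxn E * sqn x.
Proof.
rewrite /qf -mulmxA mxE; apply: le_trans (normc_sum _ _ _) _.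
rewrite /mxn mulr_suml; apply: ler_sum => i _.
rewrite !mxE normcM normc_conj; apply: le_trans (ler_wpM2l (normc_ge0 _) (normc_sum _ _ _)) _.
rewrite mulr_sumr mulr_suml; apply: ler_sum => j _.
rewrite normcM mulrCA; apply: ler_wpM2l; [exact: normc_ge0|exact: normc_le_sqn].
Qed.

Lemma posdef_qf n (M : 'M[C]_n) : posdefmx M -> forall x, x != 0 -> 0 < complex.Re (qf M x).
Proof. by case=> _ h x /h; rewrite ltcE /= => /andP[]. Qed.

End Adjoint.

(** * Diagonalisation of Hermitian pencils *)
Section Pencil.
Context {R : realType}.
Local Notation C := R[i].

Lemma herm_diag m (M : 'M[C]_m) : M ^t* = M -> exists (U : 'M[C]_m) (l : 'I_m -> R),
  [/\ U \in unitmx, U ^t* *m U = 1%:M & M = U ^t* *m rdiag l *m U].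
Proof.
move=> hM; have Mh : M \is hermsymmx by rewrite hermsymmxE hM.
pose U := spectralmx M; have Uu : U \is unitarymx by exact: spectral_unitarymx.
exists U, (fun i => complex.Re (spectral_diag M 0 i)); split.
- exact: unitarymx_unit.
- by rewrite -invmx_unitary// mulVmx// unitarymx_unit.
have dE : \row_i (complex.Re (spectral_diag M 0 i))%:C = spectral_diag M.
  apply/rowP => i; rewrite mxE RRe_real//.
  by have /mxOverP := hermitian_spectral_diag_real Mh; apply.
rewrite -invmx_unitary// /rdiag dE.
exact: (elimT (@orthomx_spectralP _ _ M) (hermitian_normalmx Mh)).
Qed.

Lemma rdiag_perm m (S : 'M[C]_m) l p :
  S ^t* *m rdiag l *m S = (row_perm p S) ^t* *m rdiag (l \o p) *m row_perm p S.
Proof.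
have E (X : 'M[C]_m) k a b : (X ^t* *m rdiag k *m X) a b = \sum_i Num.conj (X i a) * ((k i)%:C * X i b).
  by rewrite -mulmxA mxE; apply: eq_bigr => i _; rewrite rdiag_mulE !mxE.
apply/matrixP => a b; rewrite !E (reindex_inj (@perm_inj _ p)).
by apply: eq_bigr => i _; rewrite !mxE.
Qed.

Lemma rdiag1 m : rdiag (fun=> 1) = 1%:M :> 'M[C]_m.
Proof. by apply/matrixP => i j; rewrite !mxE. Qed.

(** A congruence taking the form W to the identity and H to diag(l): the columns
    of the inverse of S are W-orthonormal eigenvectors of the pencil H - lam W,
    and l lists its eigenvalues in nondecreasing order. *)
Definition pencil_diag m (H W S : 'M[C]_m) (l : 'I_m -> R) :=
  [/\ S \in unitmx, {homo l : i j / (i <= j)%N >-> i <= j},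
      H = S ^t* *m rdiag l *m S & W = S ^t* *m S].

(** With W = T^t* T from the spectral decomposition of W, the matrix
    T^-t* H T^-1 is Hermitian; diagonalising it by a unitary V gives S = V T. A
    permutation of the rows of S sorts the eigenvalues. *)
Lemma pencil_diag_exists m (H W : 'M[C]_m) : H ^t* = H -> posdefmx W ->
  exists S l, pencil_diag H W S l.
Proof.
move=> hH pW; have [hW _] := pW; rewrite hermsymmxE in hW.
have [U [w [Uu UU WE]]] := herm_diag (eqP hW).
have UUt : U *m U ^t* = 1%:M by rewrite (mulmx1C UU).
(* w i is the value of the form W at the i-th vector of the orthonormal eigenbasis. *)
have w0 i : 0 < w i.
  have := posdef_qf pW (x := U ^t* *m delta_mx i 0).
  rewrite WE qf_cong mulmxA UUt mul1mx qf_rdiag /=.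
  rewrite (bigD1 i)//= big1 ?addr0; last first.
    by move=> j ji; rewrite !mxE (negbTE ji) normc0 expr0n mulr0.
  rewrite !mxE !eqxx normc1 expr1n mulr1; apply.
  apply/eqP => /(congr1 (mulmx U)); rewrite mulmxA UUt mul1mx mulmx0 => /colP/(_ i).
  by rewrite !mxE !eqxx => /eqP; rewrite oner_eq0.
pose T := rdiag (fun i => Num.sqrt (w i)) *m U.
have Tu : T \in unitmx.
  rewrite unitmx_mul Uu andbT unitmxE det_diag unitfE prodf_seq_neq0.
  apply/allP => i _; rewrite mxE /= (_ : 0 = 0%:C)// (inj_eq (@complexI R)).
  by rewrite sqrtr_eq0 -ltNge.
have TT : T ^t* *m T = W.
  rewrite /T adjM rdiag_adj mulmxA -[X in X *m U]mulmxA rdiagM WE.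
  by have -> : (fun i => Num.sqrt (w i) * Num.sqrt (w i)) = w
    by apply/funext => i; rewrite -expr2 sqr_sqrtr// ltW.
clearbody T; pose M := (invmx T) ^t* *m H *m invmx T.
have hM : M ^t* = M by rewrite /M !adjM hH trmxCK mulmxA.
have [V [l [Vu VV ME]]] := herm_diag hM.
pose S := V *m T.
have Su : S \in unitmx by rewrite unitmx_mul Vu.
have SS : W = S ^t* *m S by rewrite /S adjM mulmxA -[X in X *m T]mulmxA VV mulmx1 TT.
have HE : H = S ^t* *m rdiag l *m S.
  have -> : S ^t* *m rdiag l *m S = T ^t* *m M *m T by rewrite ME /S adjM !mulmxA.
  by rewrite /M !mulmxA -adjM mulVmx// adj1 mul1mx mulmxKV.
have [p pP] : exists p : 'S_m, {homo (fun i => l (p i)) : i j / (i <= j)%N >-> i <= j}.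
  pose t := [tuple l i | i < m]; pose s := sort <=%R t.
  have /tuple_permP[p sE] : perm_eq s t by rewrite /s perm_sort.
  exists p => i j ij; have lE k : l (p k) = nth 0 s k.
    by rewrite sE (nth_map k) ?size_enum_ord// nth_ord_enum tnth_mktuple.
  have sz k : (k < m)%N -> k \in [pred n | (n < size s)%N] by rewrite inE size_sort size_tuple.
  rewrite !lE; apply: (sorted_leq_nth le_trans lexx) => //; try exact: sz.
  exact/sort_sorted/le_total.
exists (row_perm p S), (fun i => l (p i)); split; [|exact: pP| |].
- by rewrite row_permE unitmx_mul unitmx_perm Su.
- rewrite HE; exact: rdiag_perm.
- by have := rdiag_perm S (fun=> 1) p; rewrite rdiag1 !mulmx1 -SS.
Qed.

Definition free_vecs m k (c : 'I_k -> 'cV[C]_m) :=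
  forall a : 'I_k -> C, \sum_i a i *: c i = 0 -> forall i, a i = 0.

(** The family lives in the coordinate space of P, whose dimension is less than k. *)
Lemma dependent_vecs m k (c : 'I_k -> 'cV[C]_m) (P : pred 'I_m) :
  (#|P| < k)%N -> (forall i j, ~~ P j -> c i j 0 = 0) ->
  exists2 a : 'I_k -> C, \sum_i a i *: c i = 0 & exists i, a i != 0.
Proof.
move=> Pk cP; pose M : 'M[C]_(k, #|P|) := \matrix_(i, j) c i (enum_val j) 0.
have : kermx M != 0.
  by rewrite -mxrank_eq0 mxrank_ker subn_eq0 -ltnNge (leq_ltn_trans (rank_leq_col M)).
case/rowV0Pn => v /sub_kermxP vM v0.
exists (fun i => v 0 i); last first.
  case/rV0Pn: v0 => i vi; by exists i.
apply/colP => j; rewrite summxE mxE.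
have [Pj|nPj] := boolP (P j); last by rewrite big1// => i _; rewrite mxE cP// mulr0.
have := congr1 (fun X : 'rV_#|P| => X 0 (enum_rank_in Pj j)) vM; rewrite !mxE => E.
rewrite -[RHS]E; apply: eq_bigr => i _; by rewrite !mxE enum_rankK_in.
Qed.

(** The two ways of writing the perturbed form used in
    [pencil_eig_continuous]: the positive form subtracted at the end is the one of
    the first or of the second pencil. *)
Section Shift.
Variables (K : comNzRingType) (m : nat) (H1 H2 W1 W2 : 'M[K]_m) (s e : K).

Lemma pencil_shift_after : H2 - (s + e) *: W2 =
  (H1 - s *: W1) + ((H2 - H1) - (s + e) *: (W2 - W1) + (- e) *: W1).
Proof. apply/matrixP => i j; rewrite !mxE; ring. Qed.

Lemma pencil_shift_before : H2 - (s + e) *: W2 =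
  (H1 - s *: W1) + ((H2 - H1) - s *: (W2 - W1) + (- e) *: W2).
Proof. apply/matrixP => i j; rewrite !mxE; ring. Qed.

End Shift.

Section Diagonalised.
Variables (m : nat) (H W S : 'M[C]_m) (l : 'I_m -> R).
Hypothesis D : pencil_diag H W S l.

(** In the coordinates S c, the matrix H - lam W is diagonal with entries l i - lam. *)
Lemma pencil_kernel (lam : C) (c : 'cV[C]_m) :
  (H - lam *: W) *m c = 0 <-> forall i, (l i)%:C != lam -> (S *m c) i 0 = 0.
Proof.
have [Su _ -> ->] := D.
have -> : (S ^t* *m rdiag l *m S - lam *: (S ^t* *m S)) *m c =
    S ^t* *m (rdiag l *m (S *m c) - lam *: (S *m c)).
  by rewrite mulmxBl mulmxBr -!scalemxAl -scalemxAr !mulmxA.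
have SE i : (rdiag l *m (S *m c) - lam *: (S *m c)) i 0 = ((l i)%:C - lam) * (S *m c) i 0.
  by rewrite mxE rdiag_mulE [X in _ + X]mxE [X in _ - X]mxE mulrBl.
split=> [E i li|h].
  have : rdiag l *m (S *m c) - lam *: (S *m c) = 0.
    have Su' : S ^t* \in unitmx by rewrite adj_unit.
    by rewrite -[LHS](mulKmx Su') E mulmx0.
  move=> /colP/(_ i); rewrite SE [RHS]mxE => /eqP; rewrite mulf_eq0 subr_eq0 (negbTE li).
  by move=> /eqP.
rewrite (_ : rdiag l *m _ - _ = 0) ?mulmx0//; apply/colP => i; rewrite SE [RHS]mxE.
by have [->|/h ->] := eqVneq (l i)%:C lam; rewrite ?subrr ?mul0r ?mulr0.
Qed.

(** By [pencil_kernel] the kernel of H - lam W is, in the coordinates S c, the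
    coordinate space of the indices i with l i = lam. *)
Lemma pencil_multiplicity (lam : C) :
  let p := count_mem lam [seq x%:C | x <- codom l] in
  (exists2 c : 'I_p -> 'cV[C]_m, forall i, (H - lam *: W) *m c i = 0 & free_vecs c) /\
  (forall c : 'I_p.+1 -> 'cV[C]_m, (forall i, (H - lam *: W) *m c i = 0) ->
     exists2 a : 'I_p.+1 -> C, \sum_i a i *: c i = 0 & exists i, a i != 0).
Proof.
pose P := [pred i | (l i)%:C == lam].
have -> : count_mem lam [seq x%:C | x <- codom l] = #|P|.
  by rewrite count_map /codom /image_mem count_map cardE size_filter enumT.
have [Su _ _ _] := D; split.
  exists (fun i => invmx S *m delta_mx (enum_val i) 0) => [i|a a0 i].
    apply/pencil_kernel => j lj; rewrite mulKVmx// mxE eqxx andbT.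
    case: eqP => // ji; have := enum_valP i; rewrite -ji inE => /eqP E.
    by rewrite E eqxx in lj.
  have : S *m \sum_i a i *: (invmx S *m delta_mx (enum_val i) 0 : 'cV_m) = 0 by rewrite a0 mulmx0.
  rewrite mulmx_sumr => /colP/(_ (enum_val i)); rewrite summxE mxE (bigD1 i)//= big1 ?addr0.
    by rewrite -scalemxAr mulKVmx// !mxE !eqxx mulr1.
  move=> j ji; rewrite -scalemxAr mulKVmx// !mxE (inj_eq enum_val_inj) eq_sym (negbTE ji) /=.
  by rewrite mulr0.
move=> c cK.
have [|i j|a aS a0] := @dependent_vecs _ _ (fun i => S *m c i) P; first exact: ltnSn.
  by rewrite inE => Pj; have /pencil_kernel := cK i; apply.
exists a => //; move: aS.
under eq_bigr do rewrite scalemxAr.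
by rewrite -mulmx_sumr => /(congr1 (mulmx (invmx S))); rewrite mulKmx// mulmx0.
Qed.

Lemma qf_pencil (t : R) x :
  complex.Re (qf (H - t%:C *: W) x) = \sum_i (l i - t) * normc ((S *m x) i 0) ^+ 2.
Proof.
have [_ _ -> ->] := D.
rewrite -scaleNr qfD qfZ qf_gram qf_cong qf_rdiag.
rewrite -rmorphN -rmorphM -rmorphD /= mulr_sumr -big_split /=.
by apply: eq_bigr => i _; rewrite mulrBl mulNr.
Qed.

(** The Courant-Fischer principle in counting form: k.+1 eigenvalues are at most t
    exactly when H - t W is nonpositive on a space of dimension k.+1. If l k <= t,
    the span of the first k.+1 eigenvectors will do. Conversely, such a space
    contains a nonzero vector without components along the first k eigenvectors,
    at which the form would be positive if l k > t. *)
Lemma pencil_eig_le (k : 'I_m) (t : R) :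
  l k <= t <-> exists2 X : 'M[C]_(m, k.+1), (forall y : 'cV_k.+1, X *m y = 0 -> y = 0) &
    forall y, complex.Re (qf (H - t%:C *: W) (X *m y)) <= 0.
Proof.
have [Su lmono _ _] := D; split=> [lkt|[X Xinj Xle]].
  exists (invmx S *m pid_mx k.+1) => [y|y].
    move=> /(congr1 (mulmx S)); rewrite mulmx0 !mulmxA mulmxV// mul1mx => E.
    have := congr1 (mulmx (pid_mx k.+1 : 'M[C]_(k.+1, m))) E.
    rewrite mulmx0 mulmxA mul_pid_mx minnn (minn_idPr _) ?ltn_ord//.
    by rewrite pid_mx_1 mul1mx.
  rewrite qf_pencil -mulmxA mulKVmx//; apply: sumr_le0 => i _.
  have [ik|ki] := leqP i k.
    by rewrite mulr_le0_ge0 ?sqr_ge0// subr_le0 (le_trans _ lkt)// lmono.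
  rewrite (_ : (pid_mx _ *m y) i 0 = 0) ?normc0 ?expr0n ?mulr0//.
  rewrite mxE big1// => j _; rewrite mxE.
  by rewrite [(_ < k.+1)%N]ltnNge ki andbF mul0r.
rewrite leNgt; apply/negP => tlk.
have [y y0 yk] : exists2 y : 'cV[C]_k.+1, y != 0 & forall i : 'I_m, (i < k)%N -> (S *m X *m y) i 0 = 0.
  pose P := [pred i : 'I_m | (i < k)%N].
  pose c (j : 'I_k.+1) : 'cV[C]_m := \col_(i < m) (if (i < k)%N then (S *m X) i j else 0).
  have [|i j|a aS [i ai]] := @dependent_vecs _ _ c P.
  - by rewrite -sum1_card -(big_ord_widen _ (fun=> 1%N) (ltnW (ltn_ord k))) sum1_card card_ord.
  - by rewrite inE mxE => /negbTE ->.
  exists (\col_i a i).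
    by apply/negP => /eqP/colP/(_ i); rewrite !mxE => /eqP; rewrite (negbTE ai).
  move=> j jk; move/colP/(_ j): aS; rewrite summxE [RHS]mxE => aS; rewrite mxE -[RHS]aS.
  by apply: eq_bigr => q _; rewrite !mxE jk mulrC.
move: y0; rewrite (Xinj y) ?eqxx//.
have := Xle y; rewrite qf_pencil mulmxA => le0.
have ge0 i : 0 <= (l i - t) * normc ((S *m X *m y) i 0) ^+ 2.
  have [/yk->|ki] := ltnP i k; first by rewrite normc0 expr0n mulr0.
  by rewrite mulr_ge0 ?sqr_ge0// subr_ge0 ltW// (lt_le_trans tlk)// lmono.
have /eqP : \sum_i (l i - t) * normc ((S *m X *m y) i 0) ^+ 2 = 0.
  by apply/eqP; rewrite eq_le le0 sumr_ge0.
rewrite psumr_eq0// => /allP z.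
have : S *m X *m y = 0.
  apply/colP => i; rewrite [RHS]mxE.
  have [/yk->//|ki] := ltnP i k.
  have := z i; rewrite mem_index_enum => /(_ isT); rewrite mulf_eq0 sqrf_eq0.
  rewrite gt_eqF ?subr_gt0 ?(lt_le_trans tlk)// ?lmono//= => /eqP; exact: eq0_normc.
by move=> /(congr1 (mulmx (invmx S))); rewrite mulmx0 -mulmxA mulKmx.
Qed.

End Diagonalised.

(** A space on which H1 - t1 W1 is nonpositive serves H2 - t2 W2 as well: the
    error E between these forms is absorbed by the term - e W. *)
Lemma pencil_eig_transfer m (H1 W1 S1 H2 W2 S2 W E : 'M[C]_m) (l1 l2 : 'I_m -> R) (K e t1 t2 : R) k :
  pencil_diag H1 W1 S1 l1 -> pencil_diag H2 W2 S2 l2 ->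
  H2 - t2%:C *: W2 = (H1 - t1%:C *: W1) + (E + (- e)%:C *: W) ->
  (forall x, sqn x <= K * complex.Re (qf W x)) -> 0 < K -> mxn E * K <= e ->
  l1 k <= t1 -> l2 k <= t2.
Proof.
move=> D1 D2 HE WK K0 Ee /(pencil_eig_le D1)[X Xinj Xle].
have [_ le2] := pencil_eig_le D2 k t2; apply: le2; exists X; first exact: Xinj.
move=> y; rewrite HE qfD [qf (E + _) _]qfD qfZ.
have := Xle y; set x := X *m y; rewrite !ReD ReZ.
have := le_trans (ler_norm _) (le_trans (normRe_le _) (qf_bound E x)).
have := ler_wpM2l (mxn_ge0 E) (WK x); have := sqn_ge0 x; have := WK x.
set q := complex.Re (qf W x); set z := complex.Re (qf E x) => Wq x0 h1 h2 h3.
have q0 : 0 <= q by move: (le_trans x0 Wq); rewrite pmulr_rge0.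
have := ler_wpM2r q0 Ee; rewrite mulrA in h1; clearbody q z => h4.
by move: h1 h2 h3 h4; lra.
Qed.

(** The form W is |S x|^2, and x is the image of S x under a fixed matrix. *)
Lemma pencil_coercive m (H W S : 'M[C]_m) (l : 'I_m -> R) : pencil_diag H W S l ->
  exists2 K, 0 < K & forall x, sqn x <= K * complex.Re (qf W x).
Proof.
move=> [Su _ _ WE]; pose T := invmx S.
exists (mxn (T ^t* *m T) + 1); first by rewrite ltr_wpDl// mxn_ge0.
move=> x; have qW : complex.Re (qf W x) = sqn (S *m x).
  by rewrite WE qf_gram.
have xE : x = T *m (S *m x) by rewrite /T mulKmx.
rewrite qW {1}xE; set y := S *m x.
have -> : sqn (T *m y) = complex.Re (qf (T ^t* *m T) y).
  by rewrite qf_gram.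
apply: le_trans (ler_norm _) _; apply: le_trans (normRe_le _) _.
apply: le_trans (qf_bound _ _) _; apply: ler_wpM2r; first exact: sqn_ge0.
by rewrite lerDl.
Qed.

(** Transferring the witness space from (H, W) at level l k to (H', W') at level
    l k + e / 2 gives the upper bound. For the lower one, l' k <= l k - e would
    transfer back to l k <= l k - e / 2; arguing by contradiction provides the
    lower level l k - e, so that no a priori bound on l' k is needed. *)
Lemma pencil_eig_continuous m (H W S : 'M[C]_m) (l : 'I_m -> R) (k : 'I_m) (e : R) :
  pencil_diag H W S l -> 0 < e -> exists2 r, 0 < r &
  forall H' W' S' l', pencil_diag H' W' S' l' -> mxn (H' - H) < r -> mxn (W' - W) < r ->
    `|l' k - l k| < e.
Proof.
move=> D e0; have [K K0 WK] := pencil_coercive D.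
(* Both transfers use levels of modulus at most |l k| + e. *)
pose L := 1 + (`|l k| + e).
have L0 : 0 < L by rewrite ltr_wpDr// addr_ge0// ltW.
have KL0 : 0 < K * L by rewrite mulr_gt0.
pose r := e / 2 / (K * L); have r0 : 0 < r by rewrite !divr_gt0.
exists r => // H' W' S' l' D' Hr Wr.
have small (t : R) (E F : 'M[C]_m) : mxn E < r -> mxn F < r -> `|t| <= `|l k| + e ->
    mxn (E - t%:C *: F) * K <= e / 2.
  move=> Er Fr tl; have : mxn (E - t%:C *: F) <= r * L.
    apply: le_trans (mxnD _ _) _; rewrite mxnN mxnZ /L mulrDr mulr1.
    apply: lerD; first exact: ltW.
    have -> : normc t%:C = `|t| by rewrite /= expr0n addr0 sqrtr_sqr.
    by rewrite mulrC ler_pM ?mxn_ge0// ltW.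
  move=> /(ler_wpM2r (ltW K0)) h; apply: le_trans h _.
  by rewrite -mulrA [L * K]mulrC divfK// gt_eqF.
have e2 : (- (e / 2))%:C = - (e / 2)%:C :> C by rewrite rmorphN.
have up : l' k <= l k + e / 2.
  apply: (pencil_eig_transfer D D' (t1 := l k)
     (E := (H' - H) - (l k + e / 2)%:C *: (W' - W)) (e := e / 2) _ WK K0) => //.
    rewrite e2 rmorphD; exact: pencil_shift_after.
  apply: small => //; apply: le_trans (ler_normD _ _) _; rewrite lerD2l gtr0_norm//; lra.
have lo : l k - e < l' k.
  rewrite ltNge; apply/negP => le'.
  suff : l k <= l k - e / 2 by lra.
  apply: (pencil_eig_transfer D' D (t1 := l k - e)
     (E := (H - H') - (l k - e)%:C *: (W - W')) (e := e / 2) _ WK K0) => //.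
    have -> : l k - e / 2 = l k - e + e / 2 by lra.
    rewrite e2 [(l k - e + _)%:C]rmorphD; exact: pencil_shift_before.
  apply: small; [by rewrite -opprB mxnN|by rewrite -opprB mxnN|].
  by apply: le_trans (ler_normB _ _) _; rewrite [`|e|]gtr0_norm.
by rewrite ltr_norml; apply/andP; split; lra.
Qed.

End Pencil.

(** * Entrywise convergence of matrices *)
Section Convergence.
Context {R : realType} {T : Type}.
Local Notation C := R[i].
(* B r stands for the ball of radius r about a fixed point. *)
Variable B : R -> T -> Prop.
Hypothesis Bmono : forall r r' w, r <= r' -> B r w -> B r' w.

Definition tends m n (F : T -> 'M[C]_(m, n)) (M : 'M[C]_(m, n)) :=
  forall e, 0 < e -> exists2 r, 0 < r & forall w, B r w -> mxn (F w - M) < e.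

Lemma tends_cst m n (M : 'M[C]_(m, n)) : tends (fun=> M) M.
Proof. by move=> e e0; exists 1 => // w _; rewrite subrr /mxn big1// => i _; rewrite big1// => j _; rewrite mxE normc0. Qed.

Lemma tendsD m n (F G : T -> 'M[C]_(m, n)) M L : tends F M -> tends G L ->
  tends (fun w => F w + G w) (M + L).
Proof.
move=> FM GL e e0; have e2 : 0 < e / 2 by rewrite divr_gt0.
have [r1 r10 r1P] := FM _ e2; have [r2 r20 r2P] := GL _ e2.
exists (Num.min r1 r2); first by rewrite lt_min r10.
move=> w Bw; rewrite opprD addrACA; apply: le_lt_trans (mxnD _ _) _.
have Bw1 : B r1 w by apply: Bmono Bw; rewrite ge_min lexx.
have Bw2 : B r2 w by apply: Bmono Bw; rewrite ge_min lexx orbT.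
have := r1P w Bw1; have := r2P w Bw2.
by lra.
Qed.

Lemma tends_sum m n I (s : seq I) (F : I -> T -> 'M[C]_(m, n)) M :
  (forall i, tends (F i) (M i)) -> tends (fun w => \sum_(i <- s) F i w) (\sum_(i <- s) M i).
Proof.
move=> FM; elim: s => [|i s IH].
  have := tends_cst (0 : 'M[C]_(m, n)); rewrite big_nil; congr tends.
  by apply/funext => w; rewrite big_nil.
have := tendsD (FM i) IH; rewrite big_cons; congr tends.
by apply/funext => w; rewrite big_cons.
Qed.

Lemma tends_mul m n p q (A : 'M[C]_(p, m)) (A' : 'M[C]_(n, q)) (F : T -> 'M[C]_(m, n)) M :
  tends F M -> tends (fun w => A *m F w *m A') (A *m M *m A').
Proof.
move=> FM e e0; pose k := mxn A * mxn A' + 1.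
have k0 : 0 < k by rewrite ltr_wpDl// mulr_ge0// mxn_ge0.
have [|r r0 rP] := FM (e / k); first by rewrite divr_gt0.
exists r => // w /rP; rewrite ltr_pdivlMr// => Fe.
rewrite -mulmxBl -mulmxBr; apply: le_lt_trans Fe.
apply: le_trans (mxnM _ _) _; apply: le_trans (ler_wpM2r (mxn_ge0 _) (mxnM _ _)) _.
have := mxn_ge0 (F w - M); rewrite /k; nra.
Qed.

(** From Y - X = - Y (P - M) X for the inverses X of M and Y of P. *)
Lemma tends_inv m (F : T -> 'M[C]_m) M : M \in unitmx ->
  (forall r w, B r w -> F w \in unitmx) ->
  tends F M -> tends (fun w => invmx (F w)) (invmx M).
Proof.
move=> Mu Fu FM e e0; set X := invmx M; pose x := mxn X + 1.
have x0 : 0 < x by rewrite ltr_wpDl// mxn_ge0.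
pose h := Num.min (2^-1 / x) (e / 2 / x ^+ 2).
have h0 : 0 < h by rewrite lt_min !divr_gt0// exprn_gt0.
have [r r0 rP] := FM _ h0; exists r => // w Bw.
have := rP w Bw; have := Fu r w Bw; set P := F w; set Y := invmx P => Pu Eh.
have YX : Y - X = - (Y *m (P - M) *m X).
  by rewrite mulmxBr mulVmx// mulmxBl mul1mx -mulmxA mulmxV// mulmx1 opprB.
have : mxn (Y - X) <= mxn Y * mxn (P - M) * mxn X.
  rewrite YX mxnN; apply: le_trans (mxnM _ _) _.
  by apply: ler_wpM2r; [exact: mxn_ge0|exact: mxnM].
have : mxn Y <= mxn (Y - X) + mxn X by rewrite -{1}[Y](subrK X); exact: mxnD.
move: Eh; rewrite lt_min => /andP[]; rewrite !ltr_pdivlMr ?exprn_gt0//.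
have := mxn_ge0 Y; have := mxn_ge0 (P - M); have := mxn_ge0 X; have := mxn_ge0 (Y - X).
have : mxn X <= x by rewrite lerDl.
set a := mxn (Y - X); set b := mxn Y; set c := mxn (P - M); set z := mxn X.
move=> zx a0 z0 c0 b0 c1 c2 ba abc.
(* a <= (a + z) c z with c z <= 1 / 2, hence a <= 2 c z^2 < e. *)
have cz : c * z <= 2^-1 by apply: le_trans (ltW c1); rewrite ler_wpM2l.
have h1 : a <= (a + z) * (c * z).
  by apply: le_trans abc _; rewrite -mulrA ler_wpM2r// mulr_ge0.
have h2 : a * (c * z) <= a * 2^-1 by rewrite ler_wpM2l.
have h3 : z * (c * z) <= c * x ^+ 2.
  by rewrite mulrCA ler_wpM2l// expr2 ler_pM.
have : a <= a * 2^-1 + c * x ^+ 2 by rewrite mulrDl in h1; lra.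
lra.
Qed.

End Convergence.


(** * Self-adjoint boundary conditions and the three-term system *)
Section BoundaryAlgebra.
Context {R : realType} {d : nat}.
Local Notation C := R[i].
Variables A B : 'M[C]_(d + d).
Hypothesis AB : self_adjoint_bc A B.

(** The boundary values form a Lagrangian space. The vectors (B^t* t, - A^t* t)
    satisfy the boundary condition because A B^t* = B A^t*; they form a space of
    dimension 2d, which is the dimension of the space of all solutions. *)
Lemma self_adjoint_bc_range (x z : 'cV[C]_(d + d)) :
  A *m x + B *m z = 0 -> exists t, x = B ^t* *m t.
Proof.
have [rAB ABBA] := AB => Exz.
pose M := row_mx A B; pose K := row_mx B (- A).
have rK : \rank (map_mx Num.conj K) = (d + d)%N.
  rewrite mxrank_map -[RHS]rAB.
  have -> : K = row_mx A B *m block_mx 0 (- 1%:M) 1%:M 0.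
    by rewrite mul_row_block !mulmx0 !mulmxN !mulmx1 add0r addr0.
  apply: mxrankMfree; rewrite row_free_unit.
  have : block_mx 0 (- 1%:M) 1%:M 0 *m block_mx 0 1%:M (- 1%:M) 0 = 1%:M :> 'M[C]_(d + d + (d + d)).
    rewrite mulmx_block !mulmx0 !mul0mx mulmxN !mulmx1 opprK !addr0 !add0r.
    by rewrite -scalar_mx_block.
  by move=> /mulmx1_unit[J1 _]; exact: J1.
have KM : map_mx Num.conj K *m M^T = 0.
  rewrite map_row_mx tr_row_mx mul_row_col map_mxN mulNmx.
  have := congr1 (fun X : 'M[C]_(d + d) => map_mx Num.conj X) ABBA; rewrite /= !map_mxM.
  have cK (X : 'M[C]_(d + d)) : map_mx Num.conj (X ^t*) = X^T.
    by apply/matrixP => i j; rewrite !mxE conjCK.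
  by rewrite !cK => ->; rewrite subrr.
have KE : (map_mx Num.conj K :=: kermx M^T)%MS.
  apply/eqmxP; apply/andP; split; first exact/sub_kermxP.
  have/sub_kermxP/mxrank_leqif_sup := KM; rewrite rK mxrank_ker mxrank_tr rAB addnK.
  by case=> _; rewrite eqxx => <-.
have : (row_mx x^T z^T <= map_mx Num.conj K)%MS.
  rewrite KE; apply/sub_kermxP.
  by rewrite /M tr_row_mx mul_row_col -!trmx_mul -linearD Exz linear0.
case/submxP => t.
rewrite map_row_mx mul_mx_row => /eq_row_mx[xt _].
by exists t^T; rewrite -[LHS]trmxK xt trmx_mul map_trmx.
Qed.

(** The admissible values of u at the nodes 0..N: those at the N - 1 interior nodes
    are free and the boundary pair (- u 0, u N) ranges over the range of B^t*, of
    dimension rank B. This space depends on the boundary condition only, and its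
    dimension is the number of eigenvalues. The matrix U i reads off the value at
    node i; T picks a preimage of the boundary pair under B^t*. *)
Lemma self_adjoint_bc_parametrisation N : (0 < d)%N -> (0 < N)%N ->
  let m := ((N - 1) * d + \rank B)%N in
  exists (U : nat -> 'M[C]_(d, m)) (T : 'M[C]_(d + d, m)),
  [/\ col_mx (- U 0%N) (U N) = B ^t* *m T,
      forall c : 'cV_m, (forall i, (i <= N)%N -> U i *m c = 0) -> c = 0 &
      forall (u : nat -> 'cV[C]_d) t, col_mx (- u 0%N) (u N) = B ^t* *m t ->
        exists c : 'cV_m, forall i, (i <= N)%N -> U i *m c = u i].
Proof.
move=> d0 N0 m; set r := \rank B.
pose G : 'M[C]_(d + d, r) := (row_base B) ^t*.
have BG : B ^t* = G *m (col_base B) ^t* by rewrite /G -adjM mulmx_base.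
have Binv : (col_base B) ^t* *m (pinvmx (col_base B)) ^t* = 1%:M.
  by rewrite -adjM mulVpmx ?adj1// col_base_full.
have Ginj (c : 'cV_r) : G *m c = 0 -> c = 0.
  move=> /(congr1 (fun X => X ^t*)); rewrite adjM trmxCK.
  rewrite (_ : (0 : 'cV_(d + d)) ^t* = 0 *m row_base B); last first.
    by rewrite mul0mx trmx0 map_mx0.
  move=> /(row_free_inj (row_base_free B)) c0.
  by rewrite -[c]trmxCK c0 trmx0 map_mx0.
(* Coordinate (i - 1) d + k is the k-th entry at the interior node i. *)
pose blk i : 'M[C]_(d, (N - 1) * d) := \matrix_(k, l) (l == (i - 1) * d + k :> nat)%N%:R.
pose U i : 'M[C]_(d, m) := if i == 0%N then row_mx 0 (- usubmx G)
  else if i == N then row_mx 0 (dsubmx G) else row_mx (blk i) 0.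
have U0 : U 0%N = row_mx 0 (- usubmx G) by [].
have UN : U N = row_mx 0 (dsubmx G) by rewrite /U eqxx -leqn0 leqNgt N0.
have Ui i : (0 < i < N)%N -> U i = row_mx (blk i) 0.
  move=> /andP[i0 iN]; by rewrite /U -leqn0 leqNgt i0 /= ltn_eqF.
have UE (c : 'cV_m) : col_mx (- (U 0%N *m c)) (U N *m c) = G *m dsubmx c.
  rewrite U0 UN -{1 2}[c]vsubmxK !mul_row_col !mul0mx !add0r mulNmx opprK.
  by rewrite -mul_col_mx vsubmxK.
exists U, (row_mx 0 ((pinvmx (col_base B)) ^t*)); split.
- rewrite mul_mx_row mulmx0 BG -mulmxA Binv mulmx1 U0 UN.
  by rewrite opp_row_mx oppr0 opprK -block_mxEv block_mxEh col_mx0 vsubmxK.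
- move=> c Uc.
  have c2 : dsubmx c = 0 by apply: Ginj; rewrite -UE !Uc// oppr0 col_mx0.
  rewrite -[c]vsubmxK c2 (_ : usubmx c = 0) ?col_mx0//.
  apply/colP => l; rewrite [RHS]mxE.
  have lE := divn_eq l d; have lN : (l %/ d < N - 1)%N by rewrite ltn_divLR.
  have qN : ((l %/ d).+1 < N)%N by move: lN; rewrite ltn_subRL add1n.
  have := Uc (l %/ d).+1; rewrite Ui ?qN//.
  rewrite -[c]vsubmxK mul_row_col mul0mx addr0 col_mxKu => /(_ _)/colP E.
  have {}E := E (ltnW qN) (Ordinal (ltn_pmod l d0)); rewrite [RHS]mxE in E.
  rewrite -[RHS]E [RHS]mxE (bigD1 l)//= big1 ?addr0; last first.
    move=> j jl; rewrite [blk _ _ _]mxE /= subSS subn0 -lE.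
    by rewrite (inj_eq (@ord_inj _)) (negbTE jl) mul0r.
  by rewrite [blk _ _ _]mxE /= subSS subn0 -lE eqxx mul1r.
- move=> u t ut.
  pose c1 : 'cV[C]_((N - 1) * d) := \col_l u (l %/ d).+1 (Ordinal (ltn_pmod l d0)) 0.
  exists (col_mx c1 ((col_base B) ^t* *m t)) => i iN.
  have E := UE (col_mx c1 ((col_base B) ^t* *m t)).
  rewrite col_mxKd mulmxA -BG -ut in E; have [E0 EN] := eq_col_mx E.
  have [->|i0] := posnP i; first by apply: oppr_inj.
  have [->//|iN'] := eqVneq i N.
  have iN2 : (i < N)%N by rewrite ltn_neqAle iN'.
  rewrite Ui ?i0// mul_row_col mul0mx addr0; apply/colP => k.
  have lt : ((i - 1) * d + k < (N - 1) * d)%N.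
    have := ltn_ord k; have : ((i - 1).+1 * d <= (N - 1) * d)%N by rewrite leq_mul2r; lia.
    by rewrite mulSn; lia.
  rewrite mxE (bigD1 (Ordinal lt))//= big1 ?addr0; last first.
    move=> j jl; rewrite mxE (_ : (j == _ :> nat) = false) ?mul0r//.
    by apply: contraNF jl => /eqP jE; apply/eqP/val_inj.
  rewrite !mxE eqxx mul1r /= divnMDl// divn_small ?ltn_ord// addn0.
  rewrite (_ : (i - 1).+1 = i); last by lia.
  congr (u i _ 0); apply: val_inj => /=.
  by rewrite modnMDl modn_small.
Qed.

End BoundaryAlgebra.

(** Every map U i, T below is only known through the three properties of
    [self_adjoint_bc_parametrisation]. *)
Section Discrete.
Context {R : realType} {d m N : nat}.
Local Notation C := R[i].
Variables (A B : 'M[C]_(d + d)) (U : nat -> 'M[C]_(d, m)) (T : 'M[C]_(d + d, m)).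
Hypothesis AB : self_adjoint_bc A B.
Hypothesis N0 : (0 < N)%N.
Hypothesis UT : col_mx (- U 0%N) (U N) = B ^t* *m T.
Hypothesis Uinj : forall c : 'cV_m, (forall i, (i <= N)%N -> U i *m c = 0) -> c = 0.
Hypothesis Usurj : forall (u : nat -> 'cV[C]_d) t, col_mx (- u 0%N) (u N) = B ^t* *m t ->
  exists c : 'cV_m, forall i, (i <= N)%N -> U i *m c = u i.

(** The energy form of the three-term system on admissible values. With X j the
    inverse of the integral of P^-1, the middle sum is the form of u |-> v; the
    last term is the boundary form, as v = - A^t* t on a boundary pair B^t* t. *)
Definition redH (Q X : nat -> 'M[C]_d) : 'M[C]_m :=
  \sum_(i < N.+1) (U i) ^t* *m Q i *m U i +
  \sum_(j < N) (U j.+1 - U j) ^t* *m X j.+1 *m (U j.+1 - U j) +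
  T ^t* *m (B *m A ^t*) *m T.

Definition redW (W : nat -> 'M[C]_d) : 'M[C]_m :=
  \sum_(i < N.+1) (U i) ^t* *m W i *m U i.

Lemma redH_herm Q X : (forall i, (i <= N)%N -> (Q i) ^t* = Q i) ->
  (forall j, (1 <= j <= N)%N -> (X j) ^t* = X j) -> (redH Q X) ^t* = redH Q X.
Proof.
move=> hQ hX; rewrite /redH !adjD !adj_sum; congr (_ + _ + _).
- by apply: eq_bigr => i _; rewrite !adjM trmxCK hQ ?mulmxA// -ltnS.
- by apply: eq_bigr => i _; rewrite !adjM trmxCK hX ?mulmxA//=.
- by rewrite !adjM !trmxCK; have [_ ->] := AB; rewrite !mulmxA.
Qed.

Lemma redW_posdef W : (forall i, (i <= N)%N -> posdefmx (W i)) -> posdefmx (redW W).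
Proof.
move=> pW; split.
  rewrite hermsymmxE /redW adj_sum; apply/eqP; apply: eq_bigr => i _.
  have [] := pW i; first by rewrite -ltnS.
  by rewrite hermsymmxE => /eqP hW _; rewrite !adjM trmxCK hW mulmxA.
move=> x x0; have [i iN Ui] : exists2 i, (i < N.+1)%N & U i *m x != 0.
  apply: contrapT => h; case/eqP: x0; apply: Uinj => i iN.
  by apply: contrapT => /eqP h'; apply: h; exists i.
have E : (x ^t* *m redW W *m x) 0 0 = \sum_(i < N.+1) qf (W i) (U i *m x).
  rewrite /redW mulmx_sumr mulmx_suml summxE; apply: eq_bigr => j _.
  by rewrite -qf_cong /qf.
rewrite E (bigD1 (Ordinal iN))//=; apply: ltr_wpDr.
  apply: sumr_ge0 => j _; have [->|Uj] := eqVneq (U j *m x) 0; first by rewrite /qf mulmx0 mxE.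
  by apply: ltW; apply: (pW j _).2 => //; rewrite -ltnS.
by apply: (pW i _).2; rewrite // -ltnS.
Qed.

(** The integrated equations: u i is the value on the i-th interval carrying Q and
    W; v j.+1 is the value on the interval between nodes j and j.+1, whereas v 0
    and v N.+1 are the boundary values of v. *)
Definition disc_system (Q W P : nat -> 'M[C]_d) (lam : C) (u v : nat -> 'cV[C]_d) :=
  [/\ forall j, (j < N)%N -> u j.+1 - u j = P j.+1 *m v j.+1,
      forall i, (i <= N)%N -> v i.+1 - v i = (Q i - lam *: W i) *m u i &
      A *m col_mx (- u 0%N) (u N) + B *m col_mx (v 0%N) (v N.+1) = 0].

Lemma summation_by_parts (phi v : nat -> 'cV[C]_d) :
  \sum_(i < N.+1) (phi i) ^t* *m (v i.+1 - v i) +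
  \sum_(j < N) (phi j.+1 - phi j) ^t* *m v j.+1 =
  (col_mx (- phi 0%N) (phi N)) ^t* *m col_mx (v 0%N) (v N.+1).
Proof.
rewrite tr_col_mx map_row_mx mul_row_col linearN map_mxN mulNmx.
rewrite big_ord_recr /= addrAC -big_split /=.
under eq_bigr => i _ do
  rewrite mulmxBr adjB mulmxBl addrC addrA subrK.
rewrite -(big_mkord xpredT (fun i => (phi i.+1) ^t* *m v i.+1 - (phi i) ^t* *m v i)).
by rewrite telescope_sumr// mulmxBr addrC addrA subrK addrC.
Qed.

Variables Q W X P : nat -> 'M[C]_d.
Hypothesis XP : forall j, (1 <= j <= N)%N -> P j \in unitmx /\ X j = invmx (P j).

(** The weak formulation of the three-term system, with the defect of the boundary
    condition and the defects of the node equations made explicit. The kernel of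
    the pencil is compared with the solutions of the system by choosing c'. *)
Lemma weak_form lam (c c' : 'cV[C]_m) (v : nat -> 'cV[C]_d) :
  (forall j, (j < N)%N -> v j.+1 = X j.+1 *m (U j.+1 *m c - U j *m c)) ->
  c' ^t* *m ((redH Q X - lam *: redW W) *m c) =
    (B ^t* *m T *m c') ^t* *m (col_mx (v 0%N) (v N.+1) + A ^t* *m T *m c) +
    \sum_(i < N.+1) (U i *m c') ^t* *m
      ((Q i - lam *: W i) *m (U i *m c) - (v i.+1 - v i)).
Proof.
move=> vE.
have E1 : c' ^t* *m (redW W *m c) = \sum_(i < N.+1) (U i *m c') ^t* *m (W i *m (U i *m c)).
  by rewrite /redW mulmx_suml mulmx_sumr; apply: eq_bigr => i _; rewrite adjM !mulmxA.
have E2 : c' ^t* *m (redH Q X *m c) =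
    \sum_(i < N.+1) (U i *m c') ^t* *m (Q i *m (U i *m c)) +
    \sum_(j < N) (U j.+1 *m c' - U j *m c') ^t* *m v j.+1 +
    (B ^t* *m T *m c') ^t* *m (A ^t* *m T *m c).
  rewrite /redH !mulmxDl !mulmxDr !mulmx_suml !mulmx_sumr; congr (_ + _ + _).
  - by apply: eq_bigr => i _; rewrite adjM !mulmxA.
  - apply: eq_bigr => j _; by rewrite vE// -!mulmxBl adjM !mulmxA.
  - by rewrite !adjM trmxCK !mulmxA.
have := summation_by_parts (fun i => U i *m c') v; rewrite -mulNmx -mul_col_mx UT => E3.
have E4 : \sum_(i < N.+1) (U i *m c') ^t* *m
      ((Q i - lam *: W i) *m (U i *m c) - (v i.+1 - v i)) =
    \sum_(i < N.+1) (U i *m c') ^t* *m (Q i *m (U i *m c)) -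
    lam *: \sum_(i < N.+1) (U i *m c') ^t* *m (W i *m (U i *m c)) -
    \sum_(i < N.+1) (U i *m c') ^t* *m (v i.+1 - v i).
  rewrite scaler_sumr -!sumrB; apply: eq_bigr => i _.
  by rewrite mulmxBr mulmxBl mulmxBr -scalemxAl -scalemxAr.
rewrite mulmxBl mulmxBr -scalemxAl -scalemxAr E1 E2 E4 [in RHS]mulmxDr -E3.
have zmod (V : zmodType) (q w b l s : V) : q + w + b - l = s + w + b + (q - l - s).
  by rewrite -(addrA s) [RHS]addrC (addrA (q - l - s)) subrK -(addrA q w b) addrAC.
exact: zmod.
Qed.

(** All the defects in [weak_form] vanish, the one at the boundary because
    B A^t* = A B^t*. *)
Lemma disc_system_kernel lam u v : disc_system Q W P lam u v ->
  exists2 c, (forall i, (i <= N)%N -> U i *m c = u i) & (redH Q X - lam *: redW W) *m c = 0.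
Proof.
move=> [uv vu bc]; have [t ut] := self_adjoint_bc_range AB bc.
have [c cu] := Usurj ut; exists c => //.
set y := _ *m c.
have vX j : (j < N)%N -> v j.+1 = X j.+1 *m (U j.+1 *m c - U j *m c).
  move=> jN; have [//|Pu ->] := XP (j := j.+1).
  by rewrite !cu ?(ltnW jN)// uv// mulKmx.
have := weak_form lam y vX; rewrite big1 ?addr0; last first.
  move=> i _; have iN : (i <= N)%N by rewrite -ltnS.
  by rewrite cu// vu// subrr mulmx0.
have -> : (B ^t* *m T *m y) ^t* *m (col_mx (v 0%N) (v N.+1) + A ^t* *m T *m c) = 0.
  have Bz : B *m (col_mx (v 0%N) (v N.+1) + A ^t* *m T *m c) = 0.
    have [_ ABBA] := AB; rewrite mulmxDr !mulmxA -ABBA -!mulmxA [B ^t* *m _]mulmxA.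
    by rewrite -UT mul_col_mx mulNmx !cu// addrC bc.
  by rewrite -mulmxA adjM trmxCK -mulmxA Bz mulmx0.
rewrite -/y => /matrixP/(_ 0 0); rewrite -[y ^t*]mulmx1 -/(qf 1%:M y) qf1 mxE => y0.
by apply/eqP; apply: contraT => /sqn_gt0; rewrite -(ltcR 0) y0 ltxx.
Qed.

(** The boundary values of v are chosen so that the equations at the nodes 0 and N
    hold. Testing [weak_form] against the node defects themselves makes these
    vanish; testing against a function with prescribed boundary pair then gives
    the boundary condition. *)
Lemma kernel_disc_system lam c : (redH Q X - lam *: redW W) *m c = 0 ->
  exists v, disc_system Q W P lam (fun i => U i *m c) v.
Proof.
move=> cK.
pose K i := (Q i - lam *: W i) *m (U i *m c).
pose v0 j := X j *m (U j *m c - U j.-1 *m c).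
pose v j := if j == 0%N then v0 1%N - K 0%N else if j == N.+1 then v0 N + K N else v0 j.
have vj j : (1 <= j <= N)%N -> v j = v0 j.
  by case: j => //= j jN; rewrite /v /= ltn_eqF// ltnS.
have vX j : (j < N)%N -> v j.+1 = X j.+1 *m (U j.+1 *m c - U j *m c).
  by move=> jN; rewrite vj.
pose rho i := K i - (v i.+1 - v i).
have rho0 : rho 0%N = 0.
  by rewrite /rho vj ?N0// /v /= subKr subrr.
have rhoN : rho N = 0.
  by rewrite /rho [v N]vj ?N0 ?leqnn// /v /= eqxx [v0 N + _]addrC addrK subrr.
have weak (c' : 'cV[C]_m) :
    (col_mx (- (U 0%N *m c')) (U N *m c')) ^t* *m (col_mx (v 0%N) (v N.+1) + A ^t* *m T *m c) +
    \sum_(i < N.+1) (U i *m c') ^t* *m rho i = 0.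
  by rewrite -mulNmx -mul_col_mx UT -(weak_form lam c' vX) cK mulmx0.
have sq0 n (y : 'cV[C]_n) : y ^t* *m y = 0 -> y = 0.
  move=> /matrixP/(_ 0 0); rewrite -[y ^t*]mulmx1 -/(qf 1%:M y) qf1 mxE => y0.
  by apply/eqP; apply: contraT => /sqn_gt0; rewrite -(ltcR 0) y0 ltxx.
have rho_eq0 i : (i <= N)%N -> rho i = 0.
  move=> iN; have [|c' c'E] := Usurj (u := rho) (t := 0).
    by rewrite rho0 rhoN oppr0 col_mx0 mulmx0.
  have := weak c'; rewrite (c'E 0%N (leq0n N)) (c'E N (leqnn N)) rho0 rhoN oppr0 col_mx0.
  rewrite trmx0 map_mx0 mul0mx add0r.
  move=> /matrixP/(_ 0 0); rewrite summxE mxE => E.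
  have : \sum_(j < N.+1) sqn (rho j) = 0.
    apply: (@complexI R); rewrite rmorph_sum -[RHS]E; apply: eq_bigr => j _.
    have jN : (j <= N)%N by rewrite -ltnS.
    by rewrite (c'E j jN) -[LHS]qf1 /qf mulmx1.
  move=> /psumr_eq0P /(_ (Ordinal (iN : (i < N.+1)%N)) isT) /= z.
  apply/eqP; apply: contraT => /sqn_gt0; rewrite z ?ltxx// => j _; exact: sqn_ge0.
exists v; split.
- by move=> j jN; have [//|Pu Xe] := XP (j := j.+1); rewrite vX// Xe mulKVmx.
- by move=> i /rho_eq0/eqP; rewrite subr_eq0 => /eqP.
(* The defect s of the boundary condition is itself the test vector. *)
pose s := B *m (col_mx (v 0%N) (v N.+1) + A ^t* *m T *m c).
pose u i := if i == 0%N then - usubmx (B ^t* *m s) else dsubmx (B ^t* *m s).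
have us : col_mx (- u 0%N) (u N) = B ^t* *m s.
  by rewrite /u eqxx (gtn_eqF N0) opprK vsubmxK.
have [c' c'E] := Usurj us.
have := weak c'; rewrite big1 ?addr0; last first.
  by move=> i _; rewrite rho_eq0 ?mulmx0// -ltnS.
rewrite (c'E 0%N (leq0n N)) (c'E N (leqnn N)) us adjM trmxCK -mulmxA -/s => /sq0.
rewrite /s mulmxDr !mulmxA; have [_ <-] := AB.
by rewrite -mulNmx -mul_col_mx UT addrC !mulmxA.
Qed.

End Discrete.


(** * Vector-valued absolutely continuous functions *)
Section VectorFTC.
Context {R : realType} {d : nat}.
Local Notation C := R[i].
Local Notation mu := (@lebesgue_measure R).
Implicit Types (f g : R -> 'cV[C]_d).

Definition vabs_continuous (a b : R) f := forall i, abs_continuous a b (fun x => f x i 0).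

Definition vis_derive (x : R) f (l : 'cV[C]_d) :=
  forall i, cis_derive x (fun t => f t i 0) (l i 0).

Lemma ae_ord n (P : 'I_n -> R -> Prop) : (forall i, {ae mu, forall x, P i x}) ->
  {ae mu, forall x, forall i, P i x}.
Proof.
elim: n P => [|n IH] P aP; first by apply: aeW => x [].
have := aeI (IH _ (fun i => aP (lift ord0 i))) (aP ord0).
apply: aeS => x [h h0] i; have [j ->|->] := unliftP ord0 i; [exact: h|exact: h0].
Qed.

Lemma vabs_continuousS (a b c e : R) f : a <= c -> e <= b ->
  vabs_continuous a b f -> vabs_continuous c e f.
Proof. by move=> ac eb acf i; apply: abs_continuousS ac eb (acf i). Qed.

Lemma vabs_continuous_const (c e : R) f : vabs_continuous c e f ->
  {ae mu, forall x, x \in `]c, e[ -> vis_derive x f 0} ->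
  forall x, x \in `[c, e] -> f x = f c.
Proof.
move=> acf df x; rewrite in_itv /= => /andP[cx xe]; apply/colP => i.
apply: (abs_continuous_const (f := fun t => f t i 0) cx); first exact: abs_continuousS xe (acf i).
apply: aeS df => y h; rewrite in_itv /= => /andP[cy yx].
have := h _ i; rewrite mxE; apply; by rewrite in_itv /= cy (lt_le_trans yx).
Qed.

Lemma vabs_continuous_FTC (c e : R) f (F : R -> 'M[C]_d) (x0 : 'cV[C]_d) : c <= e ->
  vabs_continuous c e f -> mxintegrable `[c, e] F ->
  {ae mu, forall x, x \in `]c, e[ -> vis_derive x f (F x *m x0)} ->
  f e - f c = mxintegral `[c, e] F *m x0.
Proof.
move=> ce acf iF df; apply/colP => i; rewrite !mxE.
have iFx j : cintegrable `[c, e] (fun x => x0 j 0 * F x i j) by apply: cintegrableZ.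
rewrite (@abs_continuous_FTC _ c e (fun x => f x i 0) (fun x => \sum_j x0 j 0 * F x i j)) //.
- rewrite cintegral_sum//; apply: eq_bigr => j _.
  by rewrite cintegralZ// mxE mulrC.
- exact: cintegrable_sum.
apply: aeS df => x h /h/(_ i); rewrite mxE.
by under eq_bigr do rewrite mulrC.
Qed.

Lemma mxintegrableB (D : set (measurableTypeR R)) lam (F G : R -> 'M[C]_d) : measurable D ->
  mxintegrable D F -> mxintegrable D G -> mxintegrable D (fun x => F x - lam *: G x).
Proof.
move=> mD iF iG i j; have := cintegrableD mD (iF i j) (cintegrableZ (- lam) mD (iG i j)).
by congr cintegrable; apply/funext => x; rewrite !mxE mulNr.
Qed.

Lemma mxintegralB (D : set (measurableTypeR R)) lam (F G : R -> 'M[C]_d) : measurable D ->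
  mxintegrable D F -> mxintegrable D G ->
  mxintegral D (fun x => F x - lam *: G x) = mxintegral D F - lam *: mxintegral D G.
Proof.
move=> mD iF iG; apply/matrixP => i j; rewrite !mxE.
rewrite -mulNr -cintegralZ// -cintegralD//; last exact: cintegrableZ.
by congr cintegral; apply/funext => x; rewrite !mxE mulNr.
Qed.

End VectorFTC.

(** * Solutions of an equation of Atkinson type *)
Section Partition.
Context {R : realType} {N : nat} {al be : nat -> R}.
Hypothesis part : atkinson_partition N al be.

Lemma al_lt_be i : (i <= N)%N -> al i < be i. Proof. by have [+ _] := part; apply. Qed.
Lemma be_lt_al i : (i < N)%N -> be i < al i.+1. Proof. by have [_ +] := part; apply. Qed.

Lemma be_mem i : (i <= N)%N -> be i \in `[al i, be i].
Proof. by move=> iN; rewrite in_itv /= lexx andbT; exact/ltW/al_lt_be. Qed.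

Lemma al_mem j : (j < N)%N -> al j.+1 \in `[be j, al j.+1].
Proof. by move=> jN; rewrite in_itv /= lexx andbT; exact/ltW/be_lt_al. Qed.

Lemma al_le i j : (i <= j)%N -> (j <= N)%N -> al i <= al j.
Proof.
elim: j => [|j IH]; first by rewrite leqn0 => /eqP->.
rewrite leq_eqVlt => /predU1P[->//|ij] jN; apply: le_trans (IH ij (ltnW jN)) _.
by have := al_lt_be (ltnW jN); have := be_lt_al jN; lra.
Qed.

Lemma be_le i j : (i <= j)%N -> (j <= N)%N -> be i <= be j.
Proof.
elim: j => [|j IH]; first by rewrite leqn0 => /eqP->.
rewrite leq_eqVlt => /predU1P[->//|ij] jN; apply: le_trans (IH ij (ltnW jN)) _.
by have := al_lt_be jN; have := be_lt_al jN; lra.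
Qed.

Lemma be_le_al i j : (i < j)%N -> (j <= N)%N -> be i <= al j.
Proof.
move=> ij jN; apply: le_trans (ltW (be_lt_al (leq_trans ij jN))) _; exact: al_le.
Qed.

Lemma partition_cover x : x \in `[al 0%N, be N] ->
  (exists2 i, (i <= N)%N & x \in `[al i, be i]) \/
  (exists2 j, (j < N)%N & x \in `[be j, al j.+1]).
Proof.
rewrite in_itv /= => /andP[ax xb].
suff H n : (n <= N)%N -> x <= be n -> (exists2 i, (i <= N)%N & x \in `[al i, be i]) \/
  (exists2 j, (j < N)%N & x \in `[be j, al j.+1]) by exact: (H N).
elim: n => [|n IH] nN xn; first by left; exists 0%N => //; rewrite in_itv /= ax.
have [xbn|bnx] := leP x (be n); first exact: IH (ltnW nN) xbn.
have [xa|ax'] := leP x (al n.+1).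
  by right; exists n => //; rewrite in_itv /= ltW.
by left; exists n.+1 => //; rewrite in_itv /= ltW.
Qed.

End Partition.

Section Solutions.
Context {R : realType} {d N : nat} {al be : nat -> R}.
Local Notation C := R[i].
Local Notation mu := (@lebesgue_measure R).
Hypothesis part : atkinson_partition N al be.
Hypothesis N0 : (0 < N)%N.
Variable w : coeffs R d.
Hypothesis Ow : Omega N al be w.
Variable lam : C.

Local Notation a := (al 0%N).
Local Notation b := (be N).
Local Notation sol := (solution a b w lam).
Let K x := Qmx w x - lam *: Wmx w x.

Definition intQ i := mxintegral `[al i, be i] (Qmx w).
Definition intW i := mxintegral `[al i, be i] (Wmx w).
Definition intP j := mxintegral `[be j.-1, al j] (Pinv w).

Lemma itv_W_sub i x : (i <= N)%N -> x \in `]al i, be i[ -> x \in `]a, b[.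
Proof.
move=> iN; rewrite !in_itv /= => /andP[h1 h2].
by rewrite (le_lt_trans (al_le part (leq0n i) iN) h1) (lt_le_trans h2 (be_le part iN (leqnn N))).
Qed.

Lemma itv_P_sub j x : (j < N)%N -> x \in `]be j, al j.+1[ -> x \in `]a, b[.
Proof.
move=> jN; rewrite !in_itv /= => /andP[h1 h2].
have h3 := al_le part (leq0n j) (ltnW jN); have h4 := al_lt_be part (ltnW jN).
have h5 := al_lt_be part jN; have h6 := be_le part jN (leqnn N).
by apply/andP; split; lra.
Qed.

Lemma null_onW i : (i <= N)%N ->
  {ae mu, forall x, x \in `]al i, be i[ -> Pinv w x = 0}.
Proof.
move=> iN; have [_ h _] := Ow; have [h1 _] := h i iN.
by apply: aeS h1 => x /(_ _) h2 xi; apply: h2; exact: (subset_itv_oo_cc xi).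
Qed.

Lemma null_onP j : (j < N)%N ->
  {ae mu, forall x, x \in `]be j, al j.+1[ -> K x = 0}.
Proof.
move=> jN; have [_ _ h] := Ow; have [//|h1 h2 _] := h j.+1.
apply: aeS (aeI h1 h2) => x [hq hw] xj.
have xj' : `[be j, al j.+1]%classic x by exact: (subset_itv_oo_cc xj).
by rewrite /K hq// hw// scaler0 subrr.
Qed.

Lemma coeff_integrable (c e : R) : a <= c -> e <= b ->
  [/\ mxintegrable `[c, e] (Pinv w), mxintegrable `[c, e] (Qmx w) &
      mxintegrable `[c, e] (Wmx w)].
Proof.
move=> ac eb; have [[[iP _] [iQ _] [iW _]] _ _] := Ow.
have H F : mxintegrable `]a, b[ F -> mxintegrable `[c, e] (F : R -> 'M[C]_d).
  move=> iF i j; have := cintegrable_oo_cc (iF i j); apply: cintegrableS => //.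
  by apply: subset_itv; rewrite bnd_simp.
by split; exact: H.
Qed.

Lemma intKE i : (i <= N)%N -> mxintegral `[al i, be i] K = intQ i - lam *: intW i.
Proof.
move=> iN; have [_ iQ iW] := coeff_integrable (al_le part (leq0n i) iN) (be_le part iN (leqnn N)).
exact: mxintegralB.
Qed.

(** On [al i, be i] the component u is constant and only v moves; on
    [be j, al j.+1] the roles are exchanged. Freezing the constant component at an
    endpoint makes the right-hand sides independent of the unknown, so that they
    can be integrated. *)
Definition piecewise_sol (u v : R -> 'cV[C]_d) :=
  [/\ vabs_continuous a b u, vabs_continuous a b v,
   forall i, (i <= N)%N -> {ae mu, forall x, x \in `]al i, be i[ ->
     vis_derive x u 0 /\ vis_derive x v (K x *m u (al i))} &
   forall j, (j < N)%N -> {ae mu, forall x, x \in `]be j, al j.+1[ ->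
     vis_derive x v 0 /\ vis_derive x u (Pinv w x *m v (be j))}].

Lemma const_uW (u : R -> 'cV[C]_d) i : vabs_continuous a b u -> (i <= N)%N ->
  {ae mu, forall x, x \in `]al i, be i[ -> vis_derive x u 0} ->
  forall x, x \in `[al i, be i] -> u x = u (al i).
Proof.
move=> acu iN; apply: vabs_continuous_const.
exact: vabs_continuousS (al_le part (leq0n i) iN) (be_le part iN (leqnn N)) acu.
Qed.

Lemma const_vP (v : R -> 'cV[C]_d) j : vabs_continuous a b v -> (j < N)%N ->
  {ae mu, forall x, x \in `]be j, al j.+1[ -> vis_derive x v 0} ->
  forall x, x \in `[be j, al j.+1] -> v x = v (be j).
Proof.
move=> acv jN; apply: vabs_continuous_const; apply: vabs_continuousS acv.
  by have := al_le part (leq0n j) (ltnW jN); have := al_lt_be part (ltnW jN); lra.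
by have := al_lt_be part jN; have := be_le part jN (leqnn N); lra.
Qed.

Lemma solution_piecewise u v : sol u v -> piecewise_sol u v.
Proof.
move=> [acu acv du dv]; split => //.
- move=> i iN.
  have du0 : {ae mu, forall x, x \in `]al i, be i[ -> vis_derive x u 0}.
    apply: aeS (aeI du (null_onW iN)) => x [h P0] xi k.
    by have := h (itv_W_sub iN xi) k; rewrite P0// mul0mx.
  have uc := const_uW acu iN du0.
  apply: aeS (aeI dv du0) => x [h1 h2] xi; split; first exact: h2.
  by rewrite -(uc x (subset_itv_oo_cc xi)); exact: h1 (itv_W_sub iN xi).
- move=> j jN.
  have dv0 : {ae mu, forall x, x \in `]be j, al j.+1[ -> vis_derive x v 0}.
    apply: aeS (aeI dv (null_onP jN)) => x [h K0] xj k.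
    by have := h (itv_P_sub jN xj) k; rewrite -/(K x) K0// mul0mx.
  have vc := const_vP acv jN dv0.
  apply: aeS (aeI du dv0) => x [h1 h2] xj; split; first exact: h2.
  by rewrite -(vc x (subset_itv_oo_cc xj)); exact: h1 (itv_P_sub jN xj).
Qed.

Definition endpoints : set R := [set x | exists i, x = al i \/ x = be i].

Lemma ae_not_endpoints : {ae mu, forall x, ~ endpoints x}.
Proof.
have H (f : nat -> R) : {ae mu, forall x, forall i, x <> f i}.
  apply: ae_foralln => i; exists [set f i]; split => //.
    exact: lebesgue_measure_set1.
  by move=> x /=; apply: contrapT => h; apply: h => xf; apply: h.
apply: aeS (aeI (H al) (H be)) => x [h1 h2] [i [e|e]]; [exact: h1 e|exact: h2 e].
Qed.

Lemma interior_cover x : ~ endpoints x -> x \in `]a, b[ ->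
  (exists2 i, (i <= N)%N & x \in `]al i, be i[) \/
  (exists2 j, (j < N)%N & x \in `]be j, al j.+1[).
Proof.
move=> nx xab; have : x \in `[a, b] by exact: (subset_itv_oo_cc xab).
move=> /partition_cover[[i iN xi]|[j jN xj]]; [left; exists i|right; exists j] => //.
  move: xi; rewrite !in_itv /= !le_eqVlt => /andP[/predU1P[e|->] /predU1P[e'|->]] //.
  - by case: nx; exists i; left.
  - by case: nx; exists i; left.
  - by case: nx; exists i; right.
move: xj; rewrite !in_itv /= !le_eqVlt => /andP[/predU1P[e|->] /predU1P[e'|->]] //.
- by case: nx; exists j; right.
- by case: nx; exists j; right.
- by case: nx; exists j.+1; left.
Qed.

Lemma piecewise_solution u v : piecewise_sol u v -> sol u v.
Proof.
move=> [acu acv dW dP].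
have uc i : (i <= N)%N -> forall x, x \in `[al i, be i] -> u x = u (al i).
  by move=> iN; apply: const_uW => //; apply: aeS (dW i iN) => x h /h[].
have vc j : (j < N)%N -> forall x, x \in `[be j, al j.+1] -> v x = v (be j).
  by move=> jN; apply: const_vP => //; apply: aeS (dP j jN) => x h /h[].
have aW : {ae mu, forall x, forall i, (i <= N)%N -> x \in `]al i, be i[ ->
     Pinv w x = 0 /\ vis_derive x u 0 /\ vis_derive x v (K x *m u (al i))}.
  apply: ae_foralln => i; have [iN|Ni] := leqP i N; last first.
    by apply: aeW.
  by apply: aeS (aeI (dW i iN) (null_onW iN)) => x [h1 h2] _ xi; split; [exact: h2|exact: h1].
have aP : {ae mu, forall x, forall j, (j < N)%N -> x \in `]be j, al j.+1[ ->
     K x = 0 /\ vis_derive x v 0 /\ vis_derive x u (Pinv w x *m v (be j))}.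
  apply: ae_foralln => j; have [jN|Nj] := ltnP j N; last first.
    by apply: aeW.
  by apply: aeS (aeI (dP j jN) (null_onP jN)) => x [h1 h2] _ xj; split; [exact: h2|exact: h1].
have all : {ae mu, forall x, x \in `]a, b[ ->
    vis_derive x u (Pinv w x *m v x) /\ vis_derive x v (K x *m u x)}.
  apply: aeS (aeI ae_not_endpoints (aeI aW aP)) => x [nx [hW hP]] xab.
  have [[i iN xi]|[j jN xj]] := interior_cover nx xab.
    have [P0 [du dv]] := hW i iN xi.
    by rewrite P0 mul0mx (uc i iN x (subset_itv_oo_cc xi)).
  have [K0 [dv du]] := hP j jN xj.
  by rewrite K0 mul0mx (vc j jN x (subset_itv_oo_cc xj)).
split => //; by apply: aeS all => x h /h[].
Qed.

Lemma piecewise_facts u v : piecewise_sol u v ->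
  [/\ forall i x, (i <= N)%N -> x \in `[al i, be i] -> u x = u (al i),
      forall j x, (j < N)%N -> x \in `[be j, al j.+1] -> v x = v (be j),
      forall j, (j < N)%N -> u (al j.+1) - u (be j) = intP j.+1 *m v (be j) &
      forall i, (i <= N)%N -> v (be i) - v (al i) = (intQ i - lam *: intW i) *m u (al i)].
Proof.
move=> [acu acv dW dP]; split.
- by move=> i x iN; apply: const_uW => //; apply: aeS (dW i iN) => y h /h[].
- by move=> j x jN; apply: const_vP => //; apply: aeS (dP j jN) => y h /h[].
- move=> j jN; have ab : a <= be j.
    by have := al_le part (leq0n j) (ltnW jN); have := al_lt_be part (ltnW jN); lra.
  have bb : al j.+1 <= b.
    by have := al_lt_be part jN; have := be_le part jN (leqnn N); lra.
  have [iP _ _] := coeff_integrable ab bb.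
  apply: vabs_continuous_FTC iP _; [exact/ltW/(be_lt_al part)|exact: vabs_continuousS acu|].
  by apply: aeS (dP j jN) => x h /h[].
- move=> i iN; have aa := al_le part (leq0n i) iN; have bb := be_le part iN (leqnn N).
  have [_ iQ iW] := coeff_integrable aa bb; rewrite -intKE//.
  apply: vabs_continuous_FTC; [exact/ltW/(al_lt_be part)|exact: vabs_continuousS acv| |].
    exact: mxintegrableB.
  by apply: aeS (dW i iN) => x h /h[].
Qed.

(** The values of v entering [disc_system]; v has the same value at be j and al j.+1. *)
Definition node_v (v : R -> 'cV[C]_d) j := if j is j'.+1 then v (be j') else v a.

Lemma solution_nodes u v : sol u v ->
  (forall j, (j < N)%N -> u (al j.+1) - u (al j) = intP j.+1 *m node_v v j.+1) /\
  (forall i, (i <= N)%N -> node_v v i.+1 - node_v v i = (intQ i - lam *: intW i) *m u (al i)).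
Proof.
move=> /solution_piecewise/piecewise_facts[uc vc du dv]; split.
  move=> j jN; rewrite -du//; congr (_ - _); symmetry; apply: uc; first exact: ltnW.
  exact: (be_mem part (ltnW jN)).
move=> i iN; rewrite -dv//=; congr (_ - _); case: i iN => //= i iN.
symmetry; exact: (vc _ _ _ (al_mem part iN)).
Qed.

(** Vanishing nodes force v to vanish on each [be j, al j.+1], because the integral
    of P^-1 is invertible there; the remaining pieces are then constant, with a
    vanishing endpoint. *)
Lemma solution_eq0 u v : sol u v -> (forall i, (i <= N)%N -> u (al i) = 0) ->
  forall x, x \in `[a, b] -> u x = 0 /\ v x = 0.
Proof.
move=> /solution_piecewise ps u0.
have [uc vc du dv] := piecewise_facts ps; have [acu acv dW dP] := ps.
have ub j : (j < N)%N -> u (be j) = 0.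
  move=> jN; rewrite (uc j _ (ltnW jN) (be_mem part (ltnW jN))); exact: u0 (ltnW jN).
have vb j : (j < N)%N -> v (be j) = 0.
  move=> jN; have [_ _ h] := Ow; have [//|_ _ Pu] := h j.+1.
  have := du j jN; rewrite u0// ub// subrr => E.
  by rewrite -[LHS](mulKmx Pu) [X in _ *m X](esym E) mulmx0.
have va i x : (i <= N)%N -> x \in `[al i, be i] -> v x = v (al i).
  move=> iN; apply: vabs_continuous_const.
    exact: vabs_continuousS (al_le part (leq0n i) iN) (be_le part iN (leqnn N)) acv.
  by apply: aeS (dW i iN) => y h /h[_]; rewrite u0// mulmx0.
have va0 i : (i <= N)%N -> v (al i) = 0.
  move=> iN; have [iN'|Ni] := ltnP i N.
    by rewrite -(va i _ iN (be_mem part iN)); exact: vb.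
  (* The last interval has no right neighbour: use the one on its left. *)
have iE : i = N.-1.+1 by lia.
  have N1 : (N.-1 < N)%N by lia.
  by rewrite iE (vc _ _ N1 (al_mem part N1)); exact: vb.
have ua j x : (j < N)%N -> x \in `[be j, al j.+1] -> u x = u (be j).
  move=> jN; apply: vabs_continuous_const.
    apply: vabs_continuousS acu.
      by have := al_le part (leq0n j) (ltnW jN); have := al_lt_be part (ltnW jN); lra.
    by have := al_lt_be part jN; have := be_le part jN (leqnn N); lra.
  by apply: aeS (dP j jN) => y h /h[_]; rewrite vb// mulmx0.
move=> x /partition_cover[[i iN xi]|[j jN xj]].
  by rewrite (uc i x iN xi) (va i x iN xi) (u0 i iN) (va0 i iN).
by rewrite (ua j x jN xj) (vc j x jN xj) (ub j jN) (vb j jN).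
Qed.

End Solutions.

Arguments intQ {R d} al be w i.
Arguments intW {R d} al be w i.
Arguments intP {R d} al be w j.
Arguments node_v {R d} al be v j.


Section Existence.
Context {R : realType} {d N : nat} {al be : nat -> R}.
Local Notation C := R[i].
Local Notation mu := (@lebesgue_measure R).
Hypothesis part : atkinson_partition N al be.
Hypothesis N0 : (0 < N)%N.
Variable w : coeffs R d.
Hypothesis Ow : Omega N al be w.
Variable lam : C.

Local Notation a := (al 0%N).
Local Notation b := (be N).
Local Notation sol := (solution a b w lam).
Let K x := Qmx w x - lam *: Wmx w x.

Lemma vprimitive (g : R -> 'cV[C]_d) (c0 : 'cV[C]_d) :
  (forall i, cintegrable setT (fun x => g x i 0)) ->
  exists f, [/\ vabs_continuous a b f, {ae mu, forall x : R, vis_derive x f (g x)} & f a = c0].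
Proof.
move=> ig; pose G i := cprim (fun x => g x i 0).
exists (fun x => \col_i (G i x + (c0 i 0 - G i a))); split.
- move=> i; have := abs_continuousD (cprim_abs_continuous a b (ig i)) (abs_continuous_cst a b (c0 i 0 - G i a)).
  by congr abs_continuous; apply/funext => x; rewrite mxE.
- apply: aeS (ae_ord (fun i => cprim_derive (ig i))) => x h i.
  have := cis_deriveD (h i) (cis_derive_cst x (c0 i 0 - G i a)); rewrite addr0.
  by congr cis_derive; apply/funext => t; rewrite mxE.
- by apply/colP => i; rewrite mxE addrC subrK.
Qed.

(** A function given by G i on the i-th of disjoint intervals and by 0 elsewhere;
    as a sum it inherits integrability from the G i. *)
Definition glue n (c e : nat -> R) (G : nat -> R -> 'cV[C]_d) x :=
  \sum_(i < n) (if x \in `]c i, e i[%classic then G i x else 0).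

Lemma glue_integrable n (c e : nat -> R) (G : nat -> R -> 'cV[C]_d) :
  (forall i, (i < n)%N -> forall k, cintegrable `]c i, e i[ (fun x => G i x k 0)) ->
  forall k, cintegrable setT (fun x => glue n c e G x k 0).
Proof.
move=> iG k; have mI i : measurable (`]c i, e i[%classic : set (measurableTypeR R)) by [].
have := cintegrable_sum measurableT
  (fun i : 'I_n => cintegrable_patch (mI i) (iG i (ltn_ord i) k)).
congr cintegrable; apply/funext => x; rewrite /glue summxE; apply: eq_bigr => i _.
by case: ifP => // _; rewrite mxE.
Qed.

Lemma glueE n (c e : nat -> R) (G : nat -> R -> 'cV[C]_d) j x : (forall i i', (i < i' < n)%N -> e i <= c i') ->
  (j < n)%N -> x \in `]c j, e j[ -> glue n c e G x = G j x.
Proof.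
move=> dis jn xj; rewrite /glue (bigD1 (Ordinal jn))//= mem_set// big1 ?addr0// => i ij.
rewrite memNset// => xi; move: xj xi; rewrite /= !in_itv /= => /andP[h1 h2] /andP[h3 h4].
have : (i != j :> nat) by apply: contra ij => /eqP e0; apply/eqP/val_inj.
rewrite neq_ltn => /orP[lt|lt].
  have := dis i j; rewrite lt jn => /(_ isT); lra.
have := dis j i; rewrite lt ltn_ord => /(_ isT); lra.
Qed.

Lemma glue0 n (c e : nat -> R) (G : nat -> R -> 'cV[C]_d) x : (forall i, (i < n)%N -> x \notin `]c i, e i[) -> glue n c e G x = 0.
Proof.
move=> nx; rewrite /glue big1// => i _; rewrite memNset//; exact/negP/nx.
Qed.

(** The right-hand sides are known in advance from the node values, so that u and v
    are plain primitives. Integration over the intervals recovers the node values,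
    and then the primitives satisfy the system. *)
Lemma solution_exists (un vn : nat -> 'cV[C]_d) :
  (forall j, (j < N)%N -> un j.+1 - un j = intP al be w j.+1 *m vn j.+1) ->
  (forall i, (i <= N)%N -> vn i.+1 - vn i = (intQ al be w i - lam *: intW al be w i) *m un i) ->
  exists u v, [/\ sol u v, forall i, (i <= N)%N -> u (al i) = un i &
    forall i, (i <= N.+1)%N -> node_v al be v i = vn i].
Proof.
move=> unE vnE.
have al0 i : (i <= N)%N -> a <= al i by exact: (al_le part).
have beN i : (i <= N)%N -> be i <= b by move=> iN; exact: (be_le part iN).
have albe i : (i <= N)%N -> al i < be i by exact: (al_lt_be part).
have beal j : (j < N)%N -> be j < al j.+1 by exact: (be_lt_al part).
have colint (c e : R) F (x0 : 'cV[C]_d) : mxintegrable `[c, e] F ->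
    forall k, cintegrable `]c, e[ (fun x => (F x *m x0) k 0).
  move=> iF k; rewrite (_ : (fun x => _) = (fun x => \sum_j x0 j 0 * F x k j)); last first.
    by apply/funext => x; rewrite mxE; apply: eq_bigr => j _; rewrite mulrC.
  apply: cintegrable_sum => // j; apply: cintegrableZ => //.
  apply: cintegrableS (iF k j) => //; exact: subset_itv_oo_cc.
have cI i : (i <= N)%N -> mxintegrable `[al i, be i] K.
  move=> iN; have [_ iQ iW] := coeff_integrable Ow (al0 i iN) (beN i iN).
  exact: mxintegrableB.
have cJ j : (j < N)%N -> mxintegrable `[be j, al j.+1] (Pinv w).
  move=> jN; have h1 := albe j (ltnW jN); have h2 := albe j.+1 jN.
  have [|| //] := coeff_integrable Ow (c := be j) (e := al j.+1).
    by have := al0 j (ltnW jN); lra.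
  by have := beN j.+1 jN; lra.
pose gu := glue N be (fun j => al j.+1) (fun j x => Pinv w x *m vn j.+1).
pose gv := glue N.+1 al be (fun i x => K x *m un i).
have disP i i' : (i < i' < N)%N -> al i.+1 <= be i'.
  move=> /andP[ii iN]; apply: le_trans (ltW (albe i' (ltnW iN))).
  by apply: (al_le part) => //; exact: ltnW.
have disW i i' : (i < i' < N.+1)%N -> be i <= al i'.
  by move=> /andP[ii iN]; exact: (be_le_al part).
have guP j x : (j < N)%N -> x \in `]be j, al j.+1[ -> gu x = Pinv w x *m vn j.+1.
  by move=> jN xj; rewrite /gu (glueE _ disP jN xj).
have gvW i x : (i <= N)%N -> x \in `]al i, be i[ -> gv x = K x *m un i.
  by move=> iN xi; rewrite /gv (glueE _ disW iN xi).
have guW i x : (i <= N)%N -> x \in `]al i, be i[ -> gu x = 0.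
  move=> iN; rewrite in_itv /= => /andP[h1 h2]; apply: glue0 => j jN; rewrite in_itv /=.
  apply/negP => /andP[h3 h4]; have [ij|ji] := leqP i j.
    by have := be_le part ij (ltnW jN); lra.
  by have := al_le part ji iN; lra.
have gvP j x : (j < N)%N -> x \in `]be j, al j.+1[ -> gv x = 0.
  move=> jN; rewrite in_itv /= => /andP[h1 h2]; apply: glue0 => i iN; rewrite in_itv /=.
  apply/negP => /andP[h3 h4]; have [ij|ji] := leqP i j.
    by have := be_le part ij (ltnW jN); lra.
  by have := al_le part ji iN; lra.
have [u [acu du ua]] := @vprimitive gu (un 0%N)
  (glue_integrable (fun j jN => colint _ _ _ _ (cJ j jN))).
have [v [acv dv va]] := @vprimitive gv (vn 0%N)
  (glue_integrable (n := N.+1) (fun i iN => colint _ _ _ _ (cI i iN))).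
have duW i : (i <= N)%N -> {ae mu, forall x, x \in `]al i, be i[ -> vis_derive x u 0}.
  by move=> iN; apply: aeS du => x h xi; rewrite -(guW i x iN xi).
have dvP j : (j < N)%N -> {ae mu, forall x, x \in `]be j, al j.+1[ -> vis_derive x v 0}.
  by move=> jN; apply: aeS dv => x h xj; rewrite -(gvP j x jN xj).
have dvW i : (i <= N)%N -> {ae mu, forall x, x \in `]al i, be i[ -> vis_derive x v (K x *m un i)}.
  by move=> iN; apply: aeS dv => x h xi; rewrite -(gvW i x iN xi).
have duP j : (j < N)%N -> {ae mu, forall x, x \in `]be j, al j.+1[ ->
    vis_derive x u (Pinv w x *m vn j.+1)}.
  by move=> jN; apply: aeS du => x h xj; rewrite -(guP j x jN xj).
have vbe i : (i <= N)%N -> v (al i) = vn i -> v (be i) = vn i.+1.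
  move=> iN vi; have E : v (be i) - v (al i) = mxintegral `[al i, be i] K *m un i.
    apply: vabs_continuous_FTC (dvW i iN); [exact/ltW/albe| |exact: cI].
    exact: vabs_continuousS (al0 i iN) (beN i iN) acv.
  by apply: (addIr (- vn i)); rewrite vnE// -vi E (intKE part Ow).
have nodes i : (i <= N)%N -> u (al i) = un i /\ v (al i) = vn i.
  elim: i => [|i IH] iN; first by [].
  have [ui vi] := IH (ltnW iN).
  have vi' := vbe i (ltnW iN) vi.
  have ube : u (be i) = un i.
    by rewrite (const_uW part acu (ltnW iN) (duW i (ltnW iN)) (be_mem part (ltnW iN))).
  split; last first.
    by rewrite (const_vP part acv iN (dvP i iN) (al_mem part iN)).
  have E : u (al i.+1) - u (be i) = mxintegral `[be i, al i.+1] (Pinv w) *m vn i.+1.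
    apply: vabs_continuous_FTC (duP i iN); [exact/ltW/beal| |exact: cJ].
    apply: vabs_continuousS acu.
      by have := albe i (ltnW iN); have := al0 i (ltnW iN); lra.
    by have := albe i.+1 iN; have := beN i.+1 iN; lra.
  by apply: (addIr (- un i)); rewrite unE// -{1}ube E.
exists u, v; split.
- apply: (piecewise_solution part Ow); split => //.
  + move=> i iN; apply: aeS (aeI (duW i iN) (dvW i iN)) => x [h1 h2] xi.
    by split; [exact: h1|rewrite (nodes i iN).1; exact: h2].
  + move=> j jN; apply: aeS (aeI (dvP j jN) (duP j jN)) => x [h1 h2] xj.
    split; [exact: h1|rewrite (vbe j (ltnW jN) (nodes j (ltnW jN)).2); exact: h2].
- by move=> i /nodes[].
- by case=> [_|i iN] //=; apply: vbe => //; exact: (nodes i iN).2.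
Qed.

Lemma solution_lincomb k (u v : 'I_k -> R -> 'cV[C]_d) (c : 'I_k -> C) :
  (forall i, sol (u i) (v i)) ->
  sol (fun x => \sum_i c i *: u i x) (fun x => \sum_i c i *: v i x).
Proof.
move=> s; have ac (f : 'I_k -> R -> 'cV[C]_d) : (forall i, vabs_continuous a b (f i)) ->
    vabs_continuous a b (fun x => \sum_i c i *: f i x).
  move=> acf j; have := abs_continuous_sum (fun i => abs_continuousZ (c i) (acf i j)).
  congr abs_continuous; apply/funext => x; rewrite summxE.
  by apply: eq_bigr => i _; rewrite mxE.
have der (f g : 'I_k -> R -> 'cV[C]_d) (F : R -> 'M[C]_d) :
    (forall i, {ae mu, forall x, x \in `]a, b[ -> vis_derive x (f i) (F x *m g i x)}) ->
    {ae mu, forall x, x \in `]a, b[ ->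
      vis_derive x (fun x => \sum_i c i *: f i x) (F x *m (\sum_i c i *: g i x))}.
  move=> df; apply: aeS (ae_ord df) => x h xab j.
  have := cis_derive_sum (fun i => cis_deriveZ (c i) (h i xab j)).
  have -> : \sum_i c i * (F x *m g i x) j 0 = (F x *m (\sum_i c i *: g i x)) j 0.
    rewrite mulmx_sumr summxE; apply: eq_bigr => i _.
    by rewrite -scalemxAr [RHS]mxE.
  congr cis_derive; apply/funext => t; rewrite summxE.
  by apply: eq_bigr => i _; rewrite mxE.
split; [apply: ac|apply: ac|apply: der|apply: der] => i; by have [] := s i.
Qed.

End Existence.


(** * The spectrum as the spectrum of a matrix pencil *)
Section EigenvalueList.
Context {R : realType} {d : nat}.
Local Notation C := R[i].
Variables (a b : R) (w : coeffs R d) (bA : set ('M[C]_(d + d) * 'M[C]_(d + d))).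

(** A subfamily of an independent family is independent. *)
Lemma multiplicity_uniq lam m m' :
  multiplicity a b w bA lam m -> multiplicity a b w bA lam m' -> m = m'.
Proof.
suff H n n' : multiplicity a b w bA lam n -> multiplicity a b w bA lam n' -> (n' <= n)%N.
  by move=> h h'; apply/eqP; rewrite eqn_leq (H _ _ h h') (H _ _ h' h).
move=> [_ hn] [[uv [uvs uvi]] _]; rewrite leqNgt; apply/negP => nn'.
apply: (hn (fun i => uv (widen_ord nn' i))) => // c c0.
pose c' (i : 'I_n') : C := if (i < n.+1)%N then c (inord i) else 0.
have c'E i : c' (widen_ord nn' i) = c i by rewrite /c' /= ltn_ord inord_val.
have sumE (F : 'I_n' -> 'cV[C]_d) : \sum_i c' i *: F i = \sum_i c i *: F (widen_ord nn' i).
  rewrite [LHS](bigID (fun i : 'I_n' => (i < n.+1)%N)) /= [X in _ + X]big1 ?addr0; last first.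
    by move=> i ni; rewrite /c' (negbTE ni) scale0r.
  by rewrite big_ord_narrow; apply: eq_bigr => i _; rewrite c'E.
move=> i; rewrite -c'E; apply: uvi => x xab.
by rewrite (sumE (fun i => (uv i).1 x)) (sumE (fun i => (uv i).2 x)); exact: c0.
Qed.

Lemma eigenvalue_list_uniq s s' :
  eigenvalue_list a b w bA s -> eigenvalue_list a b w bA s' -> s = s'.
Proof.
move=> [ss hs] [ss' hs']; apply: (sorted_eq le_trans le_anti) => //.
apply/allP => x _ /=; apply/eqP.
have cE (t : seq R) : count_mem x t = count_mem x%:C [seq y%:C | y <- t].
  by rewrite count_map; apply: eq_count => y; exact: (esym (inj_eq (@complexI R) y x)).
by rewrite !cE; exact: multiplicity_uniq (hs _) (hs' _).
Qed.

Lemma eigenvaluesE s : eigenvalue_list a b w bA s -> eigenvalues a b w bA = s.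
Proof.
move=> hs; apply: (eigenvalue_list_uniq _ hs).
by rewrite /eigenvalues; apply: xgetPex; exists s.
Qed.

End EigenvalueList.

Section Reduction.
Context {R : realType} {d N : nat} {al be : nat -> R}.
Local Notation mu := (@lebesgue_measure R).
Local Notation C := R[i].
Hypothesis part : atkinson_partition N al be.
Hypothesis N0 : (0 < N)%N.
Variables A B : 'M[C]_(d + d).
Hypothesis AB : self_adjoint_bc A B.
Local Notation a := (al 0%N).
Local Notation b := (be N).
Local Notation bA := (bc_class A B).

Context {m : nat}.
Variables (U : nat -> 'M[C]_(d, m)) (T : 'M[C]_(d + d, m)).
Hypothesis UT : col_mx (- U 0%N) (U N) = B ^t* *m T.
Hypothesis Uinj : forall c : 'cV_m, (forall i, (i <= N)%N -> U i *m c = 0) -> c = 0.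
Hypothesis Usurj : forall (u : nat -> 'cV[C]_d) t, col_mx (- u 0%N) (u N) = B ^t* *m t ->
  exists c : 'cV_m, forall i, (i <= N)%N -> U i *m c = u i.

Lemma ae_eq_Rintegral (c e : R) (f g : R -> R) : a <= c -> e <= b ->
  mu.-integrable `[c, e] (EFin \o f) -> mu.-integrable `[c, e] (EFin \o g) ->
  {ae mu, forall x, x \in `]a, b[ -> f x = g x} ->
  \int[mu]_(x in `[c, e]) f x = \int[mu]_(x in `[c, e]) g x.
Proof.
move=> ac eb /integrableP[mf _] /integrableP[mg _] fg; congr fine.
apply: ae_eq_integral => //; apply: aeS (aeI fg (ae_not_endpoints (al := al) (be := be))).
move=> x [fgx nx] /=; rewrite in_itv /= => /andP[cx xe]; rewrite fgx// in_itv /= !lt_neqAle.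
rewrite (le_trans ac cx) (le_trans xe eb) !andbT; apply/andP; split; apply/eqP => E; apply: nx.
  by exists 0%N; left.
by exists N; right.
Qed.

(** The integrand is Hermitian only almost everywhere on the open interval (a, b). *)
Lemma mxintegral_herm (c e : R) (F : R -> 'M[C]_d) : a <= c -> e <= b ->
  hermitian_L1 N al be F -> (mxintegral `[c, e] F) ^t* = mxintegral `[c, e] F.
Proof.
move=> ac eb [iF hF].
have iF' i j : cintegrable `[c, e] (fun x => F x i j).
  have := cintegrable_oo_cc (iF i j); apply: cintegrableS => //.
  by apply: subset_itv; rewrite bnd_simp.
have Fji i j : {ae mu, forall x, x \in `]a, b[ -> F x i j = Num.conj (F x j i)}.
  apply: aeS hF => x h /h; rewrite hermsymmxE => /eqP/matrixP/(_ i j).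
  by rewrite !mxE.
apply/matrixP => i j; rewrite !mxE.
change ((\int[mu]_(x in `[c, e]) complex.Re (F x j i)) +i* - (\int[mu]_(x in `[c, e]) complex.Im (F x j i))
  = cintegral `[c, e] (fun x => F x i j)).
have [ri ii] := iF' i j; have [rj ij] := iF' j i.
congr (_ +i* _).
  apply: ae_eq_Rintegral => //; apply: aeS (Fji j i) => x h /h ->.
  by case: (F x i j).
rewrite -mulN1r -RintegralZl//; apply: ae_eq_Rintegral => //.
  exact: (integrableZl _ (-1) ij).
apply: aeS (Fji i j) => x h /h ->; rewrite mulN1r.
by case: (F x j i).
Qed.

Definition pencilH (w : coeffs R d) : 'M[C]_m :=
  redH (N := N) A B U T (intQ al be w) (fun j => invmx (intP al be w j)).
Definition pencilW (w : coeffs R d) : 'M[C]_m := redW (N := N) U (intW al be w).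

Lemma satisfies_bcP (u v : R -> 'cV[C]_d) : satisfies_bc a b bA u v <->
  A *m col_mx (- u a) (u b) + B *m col_mx (v a) (v b) = 0.
Proof.
split=> [h|h _ [M _ <-] /=]; first by apply: (h (A, B)); exists 1%:M; [exact: unitmx1|rewrite !mul1mx].
by rewrite -!mulmxA -mulmxDr h mulmx0.
Qed.

Section Fixed.
Variable w : coeffs R d.
Hypothesis Ow : Omega N al be w.

Lemma intP_unit j : (1 <= j <= N)%N ->
  intP al be w j \in unitmx /\ (fun j => invmx (intP al be w j)) j = invmx (intP al be w j).
Proof. by move=> jN; split => //; have [_ _ h] := Ow; have [] := h j jN. Qed.

Lemma eigensolution_kernel lam u v : eigensolution a b w bA lam (u, v) ->
  exists2 c, forall i, (i <= N)%N -> U i *m c = u (al i) & (pencilH w - lam *: pencilW w) *m c = 0.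
Proof.
move=> [s /satisfies_bcP bc]; have [n1 n2] := solution_nodes part Ow s.
apply: (disc_system_kernel AB UT Usurj intP_unit (u := fun i => u (al i)) (v := node_v al be v)).
have [uc _ _ _] := piecewise_facts part Ow (solution_piecewise part Ow s).
have ub : u b = u (al N) by exact: (uc N b (leqnn N) (be_mem part (leqnn N))).
by split; [exact: n1|exact: n2|rewrite -ub; exact: bc].
Qed.

Lemma kernel_eigensolution lam c : (pencilH w - lam *: pencilW w) *m c = 0 ->
  exists uv, eigensolution a b w bA lam uv /\ forall i, (i <= N)%N -> uv.1 (al i) = U i *m c.
Proof.
move=> /(kernel_disc_system AB N0 UT Usurj intP_unit)[vn [n1 n2 bc]].
have [u [v [s un vE]]] := solution_exists part Ow n1 n2.
exists (u, v); split; last exact: un.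
split; first exact: s.
apply/satisfies_bcP; rewrite /=.
have [uc _ _ _] := piecewise_facts part Ow (solution_piecewise part Ow s).
have ub : u b = u (al N) by exact: (uc N b (leqnn N) (be_mem part (leqnn N))).
have va : v a = vn 0%N by exact: (vE 0%N).
have vb : v b = vn N.+1 by exact: (vE N.+1).
by rewrite ub va vb !un.
Qed.

(** Eigensolutions and kernel vectors of the pencil correspond linearly to each
    other: a kernel vector is determined by its node values, and so is a solution
    by [solution_eq0]. *)
Lemma pencil_multiplicityP (S : 'M[C]_m) l lam : pencil_diag (pencilH w) (pencilW w) S l ->
  multiplicity a b w bA lam (count_mem lam [seq x%:C | x <- codom l]).
Proof.
move=> D; have [[c cK cfree] cdep] := pencil_multiplicity D lam; split.
  have [uv uvP] := choice (fun i => kernel_eigensolution (cK i)).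
  exists uv; split; first by move=> i; have [] := uvP i.
  move=> k k0; apply: cfree; apply: Uinj => i iN; rewrite mulmx_sumr.
  have ab : al i \in `[a, b].
    rewrite in_itv /= (al_le part) //=.
    by apply: le_trans (ltW (al_lt_be part iN)) (be_le part iN _).
  rewrite -[RHS](k0 _ ab).1; apply: eq_bigr => j _.
  by have [_ ->] := uvP j; rewrite // scalemxAr.
move=> {c cK cfree} uv uvs uvi.
have [c cP] : exists c : _ -> 'cV[C]_m, forall i,
    (forall j, (j <= N)%N -> U j *m c i = (uv i).1 (al j)) /\
    (pencilH w - lam *: pencilW w) *m c i = 0.
  have [c cP] := @choice _ _ (fun i c => (forall j, (j <= N)%N -> U j *m c = (uv i).1 (al j)) /\
    (pencilH w - lam *: pencilW w) *m c = 0) (fun i => let: ex_intro2 c h1 h2 :=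
      eigensolution_kernel (v := (uv i).2) (u := (uv i).1) (uvs i) in ex_intro _ c (conj h1 h2)).
  by exists c.
have [k k0 [i ki]] := cdep c (fun i => (cP i).2).
suff : k i = 0 by move/eqP; rewrite (negbTE ki).
apply: uvi => x xab.
have s := solution_lincomb k (fun i => (uvs i).1).
apply: (solution_eq0 part N0 Ow s) => // j jN.
transitivity (U j *m \sum_i k i *: c i); last by rewrite k0 mulmx0.
by rewrite mulmx_sumr; apply: eq_bigr => q _; rewrite -scalemxAr (cP q).1.
Qed.

Lemma pencil_exists : exists S l, pencil_diag (pencilH w) (pencilW w) S l.
Proof.
have [_ h1 _] := Ow.
apply: pencil_diag_exists; last first.
  by apply: redW_posdef => // i iN; have [] := h1 i iN.
have [[hP hQ _] _ _] := Ow.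
apply: redH_herm => // [i iN|j jN].
  by apply: mxintegral_herm hQ; [exact: (al_le part)|exact: (be_le part)].
rewrite adj_inv mxintegral_herm //; case: j jN => // j jN /=.
  by have := al_le part (leq0n j) (ltnW jN); have := al_lt_be part (ltnW jN); lra.
by have := al_lt_be part jN; have := be_le part jN (leqnn N); lra.
Qed.

Lemma pencil_eigenvalue_list (S : 'M[C]_m) l : pencil_diag (pencilH w) (pencilW w) S l ->
  eigenvalue_list a b w bA (codom l).
Proof.
move=> D; split; last by move=> lam; exact: pencil_multiplicityP D.
have [_ lmono _ _] := D; rewrite /codom /image_mem sorted_map.
apply: (@sub_sorted _ (relpre val leq)); first by move=> i j /=; exact: lmono.
rewrite -sorted_map; have -> : map val (enum 'I_m) = iota 0 m by exact: val_enum_ord.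
exact: iota_sorted.
Qed.

End Fixed.

End Reduction.


(** * Continuous dependence on the coefficients *)
Section IntegralContinuity.
Context {R : realType} {d N : nat} {al be : nat -> R}.
Local Notation C := R[i].
Local Notation mu := (@lebesgue_measure R).
Local Notation a := (al 0%N).
Local Notation b := (be N).

Lemma measurable_normc (D : set (measurableTypeR R)) (f : R -> C) :
  cintegrable D f -> measurable_fun D (fun x => normc (f x)).
Proof.
move=> [/integrableP[/measurable_EFinP fr _] /integrableP[/measurable_EFinP fi _]].
have -> : (fun x => normc (f x)) =
    Num.sqrt \o (fun x => complex.Re (f x) ^+ 2 + complex.Im (f x) ^+ 2).
  by apply/funext => x /=; case: (f x).
apply: measurableT_comp; first by apply: continuous_measurable_fun; exact: sqrt_continuous.
by apply: measurable_funD; exact: measurable_funX.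
Qed.

Lemma integral_itv_oo_cc (g : R -> R) : measurable_fun `]a, b[ g ->
  (\int[mu]_(x in `]a, b[) (g x)%:E = \int[mu]_(x in `[a, b]) (g x)%:E)%E.
Proof.
move=> mg.
have mg1 : measurable_fun `]a, b[ (EFin \o g) by exact/measurable_EFinP.
have mg' : measurable_fun `[a, b] (EFin \o g) by exact: emeasurable_fun_itv_cc mg1.
rewrite -[RHS]integral_itv_bndo_bndc; last first.
  by apply: measurable_funS mg' => //; exact: subset_itv_co_cc.
by rewrite -integral_itv_obnd_cbnd.
Qed.

(** Applied to the real and imaginary parts h of an entry of F - G. *)
Lemma le_L1dist (c e : R) (F G : R -> 'M[C]_d) (h : R -> R) : a <= c -> e <= b ->
  mxintegrable `]a, b[ F -> mxintegrable `]a, b[ G -> mu.-integrable `[a, b] (EFin \o h) ->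
  (forall x, `|h x| <= \sum_i \sum_j normc (F x i j - G x i j)) ->
  ((`|\int[mu]_(x in `[c, e]) h x|)%:E <= L1dist `]a, b[ F G)%E.
Proof.
move=> ac eb iF iG ih hle.
have sub : `[c, e] `<=` `[a, b] by apply: subset_itv; rewrite bnd_simp.
have ih' : mu.-integrable `[c, e] (EFin \o h) by apply: integrableS ih.
have mh := measurable_int mu ih.
have mg : measurable_fun `]a, b[ (fun x => \sum_i \sum_j normc (F x i j - G x i j)).
  apply: measurable_sum => i; apply: measurable_sum => j; apply: measurable_normc.
  have := cintegrableD (measurable_itv `]a, b[) (iF i j)
    (cintegrableZ (-1) (measurable_itv `]a, b[) (iG i j)).
  by congr cintegrable; apply/funext => x; rewrite mulN1r.
rewrite EFin_normr_Rintegral// /L1dist integral_itv_oo_cc//.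
apply: le_trans (le_abse_integral _ _ _) _ => //.
  exact: measurable_int ih'.
apply: le_trans (ge0_subset_integral mu _ _ _ _ sub) _ => //; first exact: measurableT_comp.
apply: ge0_le_integral => //; first exact: measurableT_comp.
  exact: (emeasurable_fun_itv_cc ((measurable_EFinP _ _).2 mg)).
by move=> x _ /=; rewrite lee_fin.
Qed.

Lemma mxintegral_L1 (c e r : R) (F G : R -> 'M[C]_d) : a <= c -> e <= b ->
  mxintegrable `]a, b[ F -> mxintegrable `]a, b[ G -> (L1dist `]a, b[ F G < r%:E)%E ->
  mxn (mxintegral `[c, e] G - mxintegral `[c, e] F) <= (d * d)%:R * (2 * r).
Proof.
move=> ac eb iF iG FG.
have iab H : mxintegrable `]a, b[ H -> mxintegrable `[a, b] (H : R -> 'M[C]_d).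
  by move=> iH i j; exact: cintegrable_oo_cc.
have sub : `[c, e] `<=` `[a, b] by apply: subset_itv; rewrite bnd_simp.
have ice H : mxintegrable `]a, b[ H -> mxintegrable `[c, e] (H : R -> 'M[C]_d).
  by move=> iH i j; exact: cintegrableS (iab H iH i j).
have mab : measurable (`[a, b]%classic : set (measurableTypeR R)) by [].
have entry i j x : normc (F x i j - G x i j) <= \sum_i \sum_j normc (F x i j - G x i j).
  rewrite (bigD1 i)//= (bigD1 j)//= -addrA lerDl addr_ge0 ?sumr_ge0// => [k _|k _].
    exact: normc_ge0.
  by rewrite sumr_ge0// => l _; exact: normc_ge0.
have -> : (d * d)%:R * (2 * r) = \sum_(i < d) \sum_(j < d) (2 * r).
  by rewrite !sumr_const !card_ord -mulrnA mulr_natl.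
apply: ler_sum => i _; apply: ler_sum => j _; rewrite !mxE.
have [fr fi] := iab _ iF i j; have [gr gi] := iab _ iG i j.
have [fr' fi'] := ice _ iF i j; have [gr' gi'] := ice _ iG i j.
apply: le_trans (normc_le _) _; rewrite mulr_natl mulr2n; apply: lerD.
- rewrite raddfB /= distrC -RintegralB// -lee_fin; apply: le_trans (ltW FG).
  apply: (le_L1dist (h := fun x => complex.Re (F x i j) - complex.Re (G x i j)) ac eb iF iG).
    by apply: eq_integrable (integrableB mab fr gr) => // x _; rewrite /= EFinB.
  by move=> x; apply: le_trans (entry i j x); rewrite -raddfB; exact: normRe_le.
- rewrite raddfB /= distrC -RintegralB// -lee_fin; apply: le_trans (ltW FG).
  apply: (le_L1dist (h := fun x => complex.Im (F x i j) - complex.Im (G x i j)) ac eb iF iG).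
    by apply: eq_integrable (integrableB mab fi gi) => // x _; rewrite /= EFinB.
  by move=> x; apply: le_trans (entry i j x); rewrite -raddfB; exact: normIm_le.
Qed.

Variable w : coeffs R d.
Hypothesis Ow : Omega N al be w.

Definition omega_ball (r : R) (w' : coeffs R d) :=
  Omega N al be w' /\ (coeffs_dist N al be w w' < r%:E)%E.

Lemma omega_ball_mono r r' w' : r <= r' -> omega_ball r w' -> omega_ball r' w'.
Proof. by move=> rr [Ow' dw]; split => //; apply: lt_le_trans dw _; rewrite lee_fin. Qed.

Lemma tends_mxintegral (c e : R) (F : coeffs R d -> R -> 'M[C]_d) : a <= c -> e <= b ->
  (forall w', Omega N al be w' -> mxintegrable `]a, b[ (F w')) ->
  (forall w', (L1dist `]a, b[ (F w) (F w') <= coeffs_dist N al be w w')%E) ->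
  tends omega_ball (fun w' => mxintegral `[c, e] (F w')) (mxintegral `[c, e] (F w)).
Proof.
move=> ac eb iF Fle eps eps0; pose k : R := (d * d)%:R * 2 + 1.
have k0 : 0 < k by rewrite ltr_wpDl// mulr_ge0// ler0n.
exists (eps / k); first by rewrite divr_gt0.
move=> w' [Ow' dw]; have := mxintegral_L1 ac eb (iF w Ow) (iF w' Ow') (le_lt_trans (Fle w') dw).
move=> h; apply: le_lt_trans h _; rewrite mulrA mulrA ltr_pdivrMr// mulrC ltr_pM2l//.
by rewrite /k ltrDl.
Qed.

Lemma L1dist_ge0 D (F G : R -> 'M[C]_d) : (0 <= L1dist D F G)%E.
Proof.
apply: integral_ge0 => x _; rewrite lee_fin.
by apply: sumr_ge0 => i _; apply: sumr_ge0 => j _; exact: normc_ge0.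
Qed.

Lemma tends_intQ (part : atkinson_partition N al be) i : (i <= N)%N ->
  tends omega_ball (fun w' => intQ al be w' i) (intQ al be w i).
Proof.
move=> iN; apply: (tends_mxintegral (F := @Qmx R d)).
- exact: (al_le part).
- exact: (be_le part).
- by move=> w' [[_ [h _] _] _ _].
- move=> w'; rewrite /coeffs_dist -addeA addeCA leeDl// adde_ge0//; exact: L1dist_ge0.
Qed.

Lemma tends_intW (part : atkinson_partition N al be) i : (i <= N)%N ->
  tends omega_ball (fun w' => intW al be w' i) (intW al be w i).
Proof.
move=> iN; apply: (tends_mxintegral (F := @Wmx R d)).
- exact: (al_le part).
- exact: (be_le part).
- by move=> w' [[_ _ [h _]] _ _].
- move=> w'; rewrite /coeffs_dist addeC leeDl// adde_ge0//; exact: L1dist_ge0.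
Qed.

Lemma tends_intP (part : atkinson_partition N al be) j : (j < N)%N ->
  tends omega_ball (fun w' => intP al be w' j.+1) (intP al be w j.+1).
Proof.
move=> jN; apply: (tends_mxintegral (F := @Pinv R d)) => /=.
- by have := al_le part (leq0n j) (ltnW jN); have := al_lt_be part (ltnW jN); lra.
- by have := al_lt_be part jN; have := be_le part jN (leqnn N); lra.
- by move=> w' [[[h _] _ _] _ _].
- move=> w'; rewrite /coeffs_dist -addeA leeDl// adde_ge0//; exact: L1dist_ge0.
Qed.

Context {m : nat}.
Variables (A B : 'M[C]_(d + d)) (U : nat -> 'M[C]_(d, m)) (T : 'M[C]_(d + d, m)).
Hypothesis part : atkinson_partition N al be.

Lemma tends_pencilW : tends omega_ball (pencilW (N := N) (al := al) (be := be) U)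
  (pencilW (N := N) (al := al) (be := be) U w).
Proof.
apply: (tends_sum omega_ball_mono) => i; apply: tends_mul; apply: tends_intW => //.
by rewrite -ltnS.
Qed.

Lemma tends_pencilH : tends omega_ball (pencilH (N := N) (al := al) (be := be) A B U T)
  (pencilH (N := N) (al := al) (be := be) A B U T w).
Proof.
apply: (tendsD omega_ball_mono); last exact: tends_cst.
apply: (tendsD omega_ball_mono).
  apply: (tends_sum omega_ball_mono) => i; apply: tends_mul; apply: tends_intQ => //.
  by rewrite -ltnS.
apply: (tends_sum omega_ball_mono) => j; apply: tends_mul; apply: tends_inv.
- by have [] := @intP_unit R d N al be w Ow j.+1 (ltn_ord j).
- by move=> r w' [Ow' _]; have [] := @intP_unit R d N al be w' Ow' j.+1 (ltn_ord j).
- exact: tends_intP.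
Qed.

End IntegralContinuity.

Theorem proposition5p4 (R : realType) (d N : nat) (al be : nat -> R)
    (A B : 'M[R[i]]_(d + d)) :
  (1 <= d)%N -> (1 < N)%N ->
  atkinson_partition N al be ->
  self_adjoint_bc A B ->
  let a := al 0%N in
  let b := be N in
  let bA := bc_class A B in
  (forall w : coeffs R d, Omega N al be w ->
     eigenvalue_list a b w bA (eigenvalues a b w bA) /\
     sharp1 a b w bA = ((N - 1) * d + \rank B)%N) /\
  (forall n : nat, (1 <= n <= (N - 1) * d + \rank B)%N ->
     continuous_on_Omega N al be (lambda a b n bA)).
Proof.
move=> d0 N1 part AB a b bA; have N0 : (0 < N)%N by exact: ltnW.
have [U [T [UT Uinj Usurj]]] := self_adjoint_bc_parametrisation B d0 N0.
set m := ((N - 1) * d + \rank B)%N in U T UT Uinj Usurj *.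
pose H := pencilH (N := N) (al := al) (be := be) A B U T.
pose W := pencilW (N := N) (al := al) (be := be) U.
have diag w : Omega N al be w -> exists S l, pencil_diag (H w) (W w) S l.
  by move=> Ow; exact: (pencil_exists part AB T Uinj Ow).
have listE w S l : Omega N al be w -> pencil_diag (H w) (W w) S l ->
    eigenvalue_list a b w bA (codom l).
  by move=> Ow; exact: (pencil_eigenvalue_list part N0 AB UT Uinj Usurj Ow).
split=> [w Ow|n nm w Ow e e0].
  have [S [l D]] := diag w Ow; have L := listE w S l Ow D.
  by rewrite /sharp1 (eigenvaluesE L) size_codom card_ord.
case: n nm => // k /= km.
have lamE w' S l : Omega N al be w' -> pencil_diag (H w') (W w') S l ->
    lambda a b k.+1 bA w' = l (Ordinal km).
  move=> Ow' D; rewrite /lambda (eigenvaluesE (listE w' S l Ow' D)) /=.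
  rewrite /codom /image_mem (nth_map (Ordinal km)) ?size_enum_ord//.
  by congr l; apply: val_inj; rewrite /= nth_enum_ord.
have [S [l D]] := diag w Ow.
have [r r0 rP] := pencil_eig_continuous (Ordinal km) D e0.
have [rH rH0 rHP] := tends_pencilH Ow A B U T part r0.
have [rW rW0 rWP] := tends_pencilW Ow U part r0.
exists (Num.min rH rW); first by rewrite lt_min rH0.
move=> w' Ow' dw; have [S' [l' D']] := diag w' Ow'.
rewrite (lamE w' S' l' Ow' D') (lamE w S l Ow D); apply: (rP _ _ _ _ D').
  by apply: rHP; split => //; apply: lt_le_trans dw _; rewrite lee_fin ge_min lexx.
by apply: rWP; split => //; apply: lt_le_trans dw _; rewrite lee_fin ge_min lexx orbT.
Qed.
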